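(* Let $\varphi:\mathbb{R}^n\times\mathbb{R}^d\to(-\infty,\infty]$ be strongly amenable in $x$ at $\bar x$ with compatible parametrization in $w$ at $\bar w$, represented near $(\bar x,\bar w)$ as $\varphi=\theta\circ h$ as in the definition below. Let $\bar y\in\partial_x\varphi(\bar x,\bar w)$, $\bar z:=h(\bar x,\bar w)$, and $$M(\bar x,\bar w,\bar y):=\{v\in\mathbb{R}^m:\ v\in\partial\theta(\bar z),\ \nabla_x h(\bar x,\bar w)^*v=\bar y\}.$$ Assume the second-order qualification condition $$\partial^2\theta(\bar z,v)(0)\cap\ker\nabla_x h(\bar x,\bar w)^*=\{0\}\quad\text{for all } v\in M(\bar x,\bar w,\bar y).$$ Then for all $u\in\mathbb{R}^n$: $$\partial^2_x\varphi(\bar x,\bar w,\bar y)(u)\subset\bigcup_{v\in M(\bar x,\bar w,\bar y)}\Big[\nabla^2_{xx}\langle v,h\rangle(\bar x,\bar w)u+\nabla_x h(\bar x,\bar w)^*\partial^2\theta(\bar z,v)\big(\nabla_x h(\bar x,\bar w)u\big)\Big],$$ $$\tilde\partial^2_x\varphi(\bar x,\bar w,\bar y)(u)\subset\bigcup_{v\in M(\bar x,\bar w,\bar y)}\Big\{\Big(\nabla^2_{xx}\langle v,h\rangle(\bar x,\bar w)u+\nabla_x h(\bar x,\bar w)^*q,\ \nabla^2_{xw}\langle v,h\rangle(\bar x,\bar w)u+\nabla_w h(\bar x,\bar w)^*q\Big)\ \Big|\ q\in\partial^2\theta(\bar z,v)\big(\nabla_x h(\bar x,\bar w)u\big)\B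ig\}.$$
   Context: Notation (all in finite dimensions, $^*$ denotes matrix transpose). For $\psi:\mathbb{R}^k\to(-\infty,\infty]$ finite at $\bar x$: the regular subdifferential is $\hat\partial\psi(\bar x)=\{v:\liminf_{x\to\bar x}\frac{\psi(x)-\psi(\bar x)-\langle v,x-\bar x\rangle}{\|x-\bar x\|}\ge0\}$; the (limiting) subdifferential $\partial\psi(\bar x)$ is the set of $v$ for which there exist $x_k\to\bar x$ with $\psi(x_k)\to\psi(\bar x)$ and $v_k\in\hat\partial\psi(x_k)$ with $v_k\to v$; the singular subdifferential $\partial^\infty\psi(\bar x)$ is the set of limits of $\lambda_kv_k$ with $\lambda_k\downarrow0$, $v_k\in\hat\partial\psi(x_k)$, $x_k\to\bar x$, $\psi(x_k)\to\psi(\bar x)$. For a set $\Omega$ and $\bar x\in\Omega$, the regular normal cone is $\hat N(\bar x;\Omega)=\{v:\limsup_{x\to\bar x,\,x\in\Omega}\langle v,x-\bar x\rangle/\|x-\bar x\|\le0\}$ and the (limiting) normal cone $N(\bar x;\Omega)$ is the set of limits of $v_k\in\hat N(x_k;\Omega)$ with $x_k\to\bar x$, $x_k\in\Omega$. The coderivative of $F:\mathbb{R}^p\rightrightarrows\mathbb{R}^q$ at $(\bar x,\bar y)\in\operatorname{gph}F$ is $D^*F(\bar x,\bar y)(v)=\{u:(u,-v)\in N((\bar x,\bar y);\operatorname{gph}F)\}$. For $\bar y\in\partial\psi(\bar x)$, the second-order subdifferential is $\partial^2\psi(\bar x,\bar y)(u):=D^*(\partial\psi)(\bar x,\bar y)(u)$.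 For $\varphi:\mathbb{R}^n\times\mathbb{R}^d\to(-\infty,\infty]$: $\partial_x\varphi(x,w):=\partial\varphi(\cdot,w)(x)$, viewed as a map $\mathbb{R}^n\times\mathbb{R}^d\rightrightarrows\mathbb{R}^n$; $\partial^2_x\varphi(\bar x,\bar w,\bar y)(u):=\partial^2\varphi(\cdot,\bar w)(\bar x,\bar y)(u)$; $\tilde\partial^2_x\varphi(\bar x,\bar w,\bar y)(u):=D^*(\partial_x\varphi)((\bar x,\bar w),\bar y)(u)\subset\mathbb{R}^n\times\mathbb{R}^d$. Strong amenability: $\varphi$ is strongly amenable in $x$ at $\bar x$ with compatible parametrization in $w$ at $\bar w$ if there is a neighborhood $V$ of $(\bar x,\bar w)$ on which $\varphi=\theta\circ h$ with $h:\mathbb{R}^n\times\mathbb{R}^d\to\mathbb{R}^m$ of class $C^2$ and $\theta:\mathbb{R}^m\to(-\infty,\infty]$ proper, lower semicontinuous and convex, such that $\partial^\infty\theta(h(\bar x,\bar w))\cap\ker\nabla_x h(\bar x,\bar w)^*=\{0\}$. For $v\in\mathbb{R}^m$, $\langle v,h\rangle(x,w):=\langle v,h(x,w)\rangle$; $\nabla^2_{xx}\langle v,h\rangle(\bar x,\bar w)u\in\mathbb{R}^n$ has $i$-th entry $\sum_k\frac{\partial^2\langle v,h\rangle}{\partial x_i\partial x_k}(\bar x,\bar w)u_k$ and $\nabla^2_{xw}\langle v,h\rangle(\bar x,\bar w)u\in\mathbb{R}^d$ has $j$-th entry $\sum_k\frac{\partial^2\langle v,h\rangle}{\partial w_j\partial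 x_k}(\bar x,\bar w)u_k$. *)

(* Defs.v *)
From Stdlib Require Import Reals.
From mathcomp Require Import ssreflect ssrfun ssrbool eqtype ssrnat seq choice fintype.

Set Implicit Arguments.
Unset Strict Implicit.

Local Open Scope R_scope.

Definition vec (k : nat) : Type := 'I_k -> R.

Definition vsum {k : nat} (f : 'I_k -> R) : R := foldr Rplus 0 (map f (enum 'I_k)).
Definition vzero {k : nat} : vec k := fun _ => 0.
Definition vadd {k : nat} (x y : vec k) : vec k := fun i => x i + y i.
Definition vopp {k : nat} (x : vec k) : vec k := fun i => - x i.
Definition vsub {k : nat} (x y : vec k) : vec k := fun i => x i - y i.
Definition vscale {k : nat} (t : R) (x : vec k) : vec k := fun i => t * x i.
Definition inner {k : nat} (x y : vec k) : R := vsum (fun i => x i * y i).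
Definition norm {k : nat} (x : vec k) : R := sqrt (inner x x).
Definition ebasis {k : nat} (i : 'I_k) : vec k := fun j => if j == i then 1 else 0.

Definition vcat {p q : nat} (a : vec p) (b : vec q) : vec (p + q)%N :=
  fun i => match split i with inl j => a j | inr j => b j end.
Definition vl {p q : nat} (z : vec (p + q)%N) : vec p := fun i => z (lshift q i).
Definition vr {p q : nat} (z : vec (p + q)%N) : vec q := fun j => z (rshift p j).

(* extended reals (-oo, +oo]: None = +oo *)
Definition ege (a : option R) (r : R) : Prop :=
  match a with None => True | Some y => r <= y end.
Definition egt (a : option R) (r : R) : Prop :=
  match a with None => True | Some y => r < y end.

Definition vcv {k : nat} (s : nat -> vec k) (l : vec k) : Prop :=
  forall eps, 0 < eps -> exists N : nat, forall j : nat, (N <= j)%nat ->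
    norm (vsub (s j) l) < eps.
Definition ecv (s : nat -> option R) (l : R) : Prop :=
  forall eps, 0 < eps -> exists N : nat, forall j : nat, (N <= j)%nat ->
    exists r, s j = Some r /\ Rabs (r - l) < eps.

(* regular subdifferential (liminf >= 0 written out) *)
Definition rsubdiff {k : nat} (psi : vec k -> option R) (xb v : vec k) : Prop :=
  exists fb, psi xb = Some fb /\
  forall eps, 0 < eps -> exists del, 0 < del /\
    forall x, 0 < norm (vsub x xb) < del ->
      ege (psi x) (fb + inner v (vsub x xb) - eps * norm (vsub x xb)).

Definition subdiff {k : nat} (psi : vec k -> option R) (xb v : vec k) : Prop :=
  exists fb, psi xb = Some fb /\
  exists (xs vs : nat -> vec k),
    vcv xs xb /\ ecv (fun j => psi (xs j)) fb /\
    (forall j, rsubdiff psi (xs j) (vs j)) /\ vcv vs v.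

Definition ssubdiff {k : nat} (psi : vec k -> option R) (xb v : vec k) : Prop :=
  exists fb, psi xb = Some fb /\
  exists (xs vs : nat -> vec k) (lam : nat -> R),
    (forall j, 0 < lam j) /\ Un_cv lam 0 /\
    vcv xs xb /\ ecv (fun j => psi (xs j)) fb /\
    (forall j, rsubdiff psi (xs j) (vs j)) /\
    vcv (fun j => vscale (lam j) (vs j)) v.

Definition rnormal {k : nat} (Om : vec k -> Prop) (xb v : vec k) : Prop :=
  Om xb /\
  forall eps, 0 < eps -> exists del, 0 < del /\
    forall x, Om x -> 0 < norm (vsub x xb) < del ->
      inner v (vsub x xb) <= eps * norm (vsub x xb).
Definition lnormal {k : nat} (Om : vec k -> Prop) (xb v : vec k) : Prop :=
  Om xb /\
  exists (xs vs : nat -> vec k),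
    (forall j, Om (xs j)) /\ vcv xs xb /\
    (forall j, rnormal Om (xs j) (vs j)) /\ vcv vs v.

(* coderivative: coderiv F xb yb v u  <->  u \in D^*F(xb,yb)(v),
   where F xb yb means yb \in F(xb) *)
Definition coderiv {p q : nat} (F : vec p -> vec q -> Prop)
    (xb : vec p) (yb : vec q) (v : vec q) (u : vec p) : Prop :=
  lnormal (fun z : vec (p + q)%N => F (vl z) (vr z)) (vcat xb yb) (vcat u (vopp v)).

Definition sosubdiff {k : nat} (psi : vec k -> option R) (xb yb u w : vec k) : Prop :=
  coderiv (subdiff psi) xb yb u w.

Definition psubdiff {n d : nat} (phi : vec n -> vec d -> option R)
    (z : vec (n + d)%N) (y : vec n) : Prop :=
  subdiff (fun x => phi x (vr z)) (vl z) y.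

Definition proper_fun {k : nat} (th : vec k -> option R) : Prop :=
  exists z, th z <> None.
Definition lsc_fun {k : nat} (th : vec k -> option R) : Prop :=
  forall z r, egt (th z) r -> exists del, 0 < del /\
    forall z', norm (vsub z' z) < del -> egt (th z') r.
Definition convex_fun {k : nat} (th : vec k -> option R) : Prop :=
  forall z1 z2 a b t, th z1 = Some a -> th z2 = Some b -> 0 <= t <= 1 ->
    exists c, th (vadd (vscale t z1) (vscale (1 - t) z2)) = Some c /\
      c <= t * a + (1 - t) * b.

Definition has_pderiv {N : nat} (F : vec N -> R) (i : 'I_N) (G : vec N -> R) : Prop :=
  forall z, derivable_pt_lim (fun t => F (vadd z (vscale t (ebasis i)))) 0 (G z).
Definition vcont {N : nat} (F : vec N -> R) : Prop :=
  forall z eps, 0 < eps -> exists del, 0 < del /\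
    forall z', norm (vsub z' z) < del -> Rabs (F z' - F z) < eps.

Definition is_C2 {n d m : nat} (h : vec n -> vec d -> vec m)
    (D1 : 'I_m -> 'I_(n + d)%N -> vec (n + d)%N -> R)
    (D2 : 'I_m -> 'I_(n + d)%N -> 'I_(n + d)%N -> vec (n + d)%N -> R) : Prop :=
  forall l : 'I_m,
    vcont (fun z : vec (n + d)%N => h (vl z) (vr z) l) /\
    forall i : 'I_(n + d)%N,
      has_pderiv (fun z : vec (n + d)%N => h (vl z) (vr z) l) i (D1 l i) /\
      vcont (D1 l i) /\
      forall j : 'I_(n + d)%N, has_pderiv (D1 l i) j (D2 l i j) /\ vcont (D2 l i j).

Section DerivOps.
Variables (n d m : nat).
Variable D1 : 'I_m -> 'I_(n + d)%N -> vec (n + d)%N -> R.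
Variable D2 : 'I_m -> 'I_(n + d)%N -> 'I_(n + d)%N -> vec (n + d)%N -> R.
Variable zb : vec (n + d)%N.

Definition jacx_t (v : vec m) : vec n :=
  fun i => vsum (fun l => v l * D1 l (lshift d i) zb).
Definition jacw_t (v : vec m) : vec d :=
  fun j => vsum (fun l => v l * D1 l (rshift n j) zb).
Definition jacx (u : vec n) : vec m :=
  fun l => vsum (fun i => D1 l (lshift d i) zb * u i).
Definition hessxx (v : vec m) (u : vec n) : vec n :=
  fun i => vsum (fun k => vsum (fun l => v l * D2 l (lshift d k) (lshift d i) zb) * u k).
Definition hessxw (v : vec m) (u : vec n) : vec d :=
  fun j => vsum (fun k => vsum (fun l => v l * D2 l (lshift d k) (rshift n j) zb) * u k).
End DerivOps.

Definition strongly_amenable_rep {n d m : nat} (phi : vec n -> vec d -> option R)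
    (xb : vec n) (wb : vec d) (theta : vec m -> option R) (h : vec n -> vec d -> vec m)
    (D1 : 'I_m -> 'I_(n + d)%N -> vec (n + d)%N -> R)
    (D2 : 'I_m -> 'I_(n + d)%N -> 'I_(n + d)%N -> vec (n + d)%N -> R) : Prop :=
  (exists del, 0 < del /\ forall x w,
      norm (vsub (vcat x w) (vcat xb wb)) < del -> phi x w = theta (h x w)) /\
  is_C2 h D1 D2 /\
  proper_fun theta /\ lsc_fun theta /\ convex_fun theta /\
  (forall v, ssubdiff theta (h xb wb) v ->
     jacx_t D1 (vcat xb wb) v = vzero -> v = vzero).

Definition Mset {n d m : nat} (theta : vec m -> option R) (h : vec n -> vec d -> vec m)
    (D1 : 'I_m -> 'I_(n + d)%N -> vec (n + d)%N -> R)
    (xb : vec n) (wb : vec d) (yb : vec n) (v : vec m) : Prop :=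
  subdiff theta (h xb wb) v /\ jacx_t D1 (vcat xb wb) v = yb.

(* Main.v *)
(** Near the reference point, [y] is a partial subgradient of [phi] at [(x, w)] iff
    [y = jacx_t v] for some subgradient [v] of [theta] at [h x w].  So, writing [s = (x, w)],
    [H s = h x w] and [A s v] for the transposed partial Jacobian at [s] applied to [v], the
    graph of the partial subdifferential is the image under [(s, v) |-> (s, A s v)] of the
    preimage under [(s, v) |-> (H s, v)] of the graph of the subdifferential of [theta].
    Regular normals pull back along the first map, which produces the Hessian terms; the
    first-order qualification condition keeps the multipliers [v] bounded in the limit.
    Normals to the preimage are described by a limiting chain rule applied to an indicator
    function, the second-order qualification condition being its qualification condition.
    The same chain rule, applied to [theta], gives the representation of partial
    subgradients. *)

(* The obstacle is that normals to the graph of a subdifferential are limits taken along points at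
   which the values of [theta] need not converge, whereas [ssubdiff] demands such convergence. The
   remedy is convexity: at points of the domain, the singular subgradients of [theta] are exactly
   the normals to its domain ([dom_normal]), a notion that mentions no values and is stable under
   limits. It turns limits of normalised unbounded multipliers into singular subgradients, and it
   carries the qualification condition, assumed only at [(xb, wb)], over to the nearby points where
   partial subgradients have to be represented.

   The indicator fed to the chain rule is that of a graph, in general not convex, so the rule is
   proved for all lower semicontinuous functions, by penalisation. Regular normals pull back at
   every point of the preimage, so multipliers may be chosen freely before passing to a limit. Both
   inclusions are instances of one statement, with [s = x] for frozen [w] and with [s = (x, w)]. *)
Require Import Defs.
From Stdlib Require Import Reals Lra Classical ClassicalEpsilon IndefiniteDescription.
From Stdlib Require Import FunctionalExtensionality.
From HB Require Import structures.
From mathcomp Require Import ssreflect ssrfun ssrbool eqtype ssrnat seq choice fintype bigop.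

Set Implicit Arguments.
Unset Strict Implicit.

Local Open Scope R_scope.

(** * Finite-dimensional vectors and sequences *)

Lemma Rplus_assoc_ssr : associative Rplus.
Proof. by move=> x y z; rewrite Rplus_assoc. Qed.
HB.instance Definition _ :=
  Monoid.isComLaw.Build R 0 Rplus Rplus_assoc_ssr Rplus_comm Rplus_0_l.

Section Sums.
Variable k : nat.
Implicit Types f g : 'I_k -> R.

Lemma vsumE f : vsum f = \big[Rplus/0]_(i < k) f i.
Proof. by rewrite -big_enum /= /vsum foldrE big_map. Qed.

Lemma eq_vsum f g : f =1 g -> vsum f = vsum g.
Proof. by move=> fg; rewrite !vsumE; apply: eq_bigr. Qed.

Lemma vsumD f g : vsum (fun i => f i + g i) = vsum f + vsum g.
Proof. by rewrite !vsumE big_split. Qed.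

Lemma vsumZ c f : vsum (fun i => c * f i) = c * vsum f.
Proof. by rewrite /vsum; elim: (enum _) => [|i s /= ->] /=; lra. Qed.

Lemma vsumB f g : vsum (fun i => f i - g i) = vsum f - vsum g.
Proof. by rewrite /vsum; elim: (enum _) => [|i s /= ->] /=; lra. Qed.

Lemma vsum_const0 : vsum (fun _ : 'I_k => 0) = 0.
Proof. by rewrite vsumE big1_eq. Qed.

Lemma le_vsum f g : (forall i, f i <= g i) -> vsum f <= vsum g.
Proof.
by move=> fg; rewrite /vsum; elim: (enum _) => [|i s IH] /=; [lra | have := fg i; lra].
Qed.

Lemma vsum_ge0 f : (forall i, 0 <= f i) -> 0 <= vsum f.
Proof. by move=> f0; rewrite -vsum_const0; apply: le_vsum. Qed.

Lemma vsum_ge_term f i : (forall j, 0 <= f j) -> f i <= vsum f.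
Proof.
move=> f0; rewrite vsumE (bigD1 i) //=.
rewrite -[X in X <= _]Rplus_0_r; apply: Rplus_le_compat_l.
by elim/big_rec: _ => [|j x _ x0]; [lra | have := f0 j; lra].
Qed.

Lemma vsum_delta f i : vsum (fun j => f j * ebasis i j) = f i.
Proof.
rewrite vsumE (bigD1 i) //= big1 /ebasis ?eqxx; first lra.
by move=> j /negbTE ->; lra.
Qed.

End Sums.

Lemma vsum_split p q (f : 'I_(p + q)%N -> R) :
  vsum f = vsum (fun i => f (lshift q i)) + vsum (fun j => f (rshift p j)).
Proof. by rewrite !vsumE big_split_ord. Qed.

Section InnerNorm.
Variable k : nat.
Implicit Types x y z : vec k.

Lemma vec_ext x y : (forall i, x i = y i) -> x = y.
Proof. exact: functional_extensionality. Qed.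

Lemma innerC x y : inner x y = inner y x.
Proof. by apply: eq_vsum => i; apply: Rmult_comm. Qed.

Lemma innerDl x y z : inner (vadd x y) z = inner x z + inner y z.
Proof. by rewrite /inner -vsumD; apply: eq_vsum => i; rewrite /vadd; lra. Qed.

Lemma innerBl x y z : inner (vsub x y) z = inner x z - inner y z.
Proof. by rewrite /inner -vsumB; apply: eq_vsum => i; rewrite /vsub; lra. Qed.

Lemma innerZl c x z : inner (vscale c x) z = c * inner x z.
Proof. by rewrite /inner -vsumZ; apply: eq_vsum => i; rewrite /vscale; lra. Qed.

Lemma innerDr x y z : inner z (vadd x y) = inner z x + inner z y.
Proof. by rewrite !(innerC z) innerDl. Qed.

Lemma innerBr x y z : inner z (vsub x y) = inner z x - inner z y.
Proof. by rewrite !(innerC z) innerBl. Qed.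

Lemma innerZr c x z : inner z (vscale c x) = c * inner z x.
Proof. by rewrite !(innerC z) innerZl. Qed.

Lemma inner0l z : inner vzero z = 0.
Proof. by rewrite -(vsum_const0 k); apply: eq_vsum => i; rewrite /vzero; lra. Qed.

Lemma inner_ebasis x i : inner (ebasis i) x = x i.
Proof. by rewrite innerC /inner vsum_delta. Qed.

Lemma inner_ge0 x : 0 <= inner x x.
Proof. by apply: vsum_ge0 => i; nra. Qed.

Lemma norm_ge0 x : 0 <= norm x.
Proof. exact: sqrt_pos. Qed.

Lemma norm_sq x : norm x * norm x = inner x x.
Proof. by apply: sqrt_sqrt; apply: inner_ge0. Qed.

Lemma norm_le_sq x r : 0 <= r -> inner x x <= r * r -> norm x <= r.
Proof. by have := norm_ge0 x; have := norm_sq x; nra. Qed.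

Lemma cauchy_schwarz x y : inner x y <= norm x * norm y.
Proof.
have sq t : 0 <= inner x x - 2 * t * inner x y + t * t * inner y y.
  have := inner_ge0 (vsub x (vscale t y)).
  by rewrite innerBl !innerBr !innerZl !innerZr (innerC y x); lra.
have n1 := norm_ge0 x; have n2 := norm_ge0 y.
have s1 := norm_sq x; have s2 := norm_sq y.
case: (Rle_lt_dec (inner x y) 0) => [|i0]; first by nra.
case: (Req_dec (norm y) 0) => [y0|y0].
  (* When [y] has norm zero the quadratic is affine in [t]; this [t] gives it the value -1. *)
  have := sq ((inner x x + 1) / (2 * inner x y)).
  rewrite -s2 y0 => H.
  have : 2 * ((inner x x + 1) / (2 * inner x y)) * inner x y = inner x x + 1 by field; lra.
  by nra.
(* This [t] makes both square terms equal to [|x|^2]. *)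
have := sq (norm x / norm y); rewrite -s1 -s2.
have -> : norm x / norm y * (norm x / norm y) * (norm y * norm y) = norm x * norm x by field.
move=> H; have {}H : norm x / norm y * inner x y <= norm x * norm x by lra.
case: (Req_dec (norm x) 0) => [x0|x0].
  have := sq (inner x y / inner y y); rewrite -s1 -s2 x0 => H2.
  have E : 2 * (inner x y / (norm y * norm y)) * inner x y =
    2 * (inner x y / (norm y * norm y) * (inner x y / (norm y * norm y)) * (norm y * norm y)).
    by field.
  have P : 0 < inner x y / (norm y * norm y) * (inner x y / (norm y * norm y)) * (norm y * norm y).
    have ? : 0 < norm y * norm y by nra.
    by apply: Rmult_lt_0_compat => //; apply: Rmult_lt_0_compat; apply: Rdiv_lt_0_compat.
  by lra.
have {}H : norm x * inner x y <= norm x * (norm x * norm y).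
  have -> : norm x * inner x y = (norm x / norm y * inner x y) * norm y by field.
  by rewrite -Rmult_assoc; apply: Rmult_le_compat_r.
by apply: Rmult_le_reg_l H; lra.
Qed.

Lemma cauchy_schwarz_abs x y : Rabs (inner x y) <= norm x * norm y.
Proof.
apply: Rabs_le; split; last exact: cauchy_schwarz.
have := cauchy_schwarz (vscale (-1) x) y; rewrite innerZl.
suff -> : norm (vscale (-1) x) = norm x by lra.
by rewrite /norm innerZl innerZr; congr sqrt; lra.
Qed.

Lemma norm_triangle x y : norm (vadd x y) <= norm x + norm y.
Proof.
have n1 := norm_ge0 x; have n2 := norm_ge0 y.
apply: norm_le_sq; first lra.
rewrite innerDl !innerDr (innerC y x); have := cauchy_schwarz x y.
by have := norm_sq x; have := norm_sq y; lra.
Qed.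

Lemma norm_scale c x : norm (vscale c x) = Rabs c * norm x.
Proof.
rewrite /norm innerZl innerZr -Rmult_assoc sqrt_mult_alt; last by nra.
by rewrite -/(Rsqr c) sqrt_Rsqr_abs.
Qed.

Lemma norm_subC x y : norm (vsub x y) = norm (vsub y x).
Proof.
rewrite /norm !innerBl !innerBr (innerC x y); congr sqrt; lra.
Qed.

Lemma norm_sub_triangle y x z : norm (vsub x z) <= norm (vsub x y) + norm (vsub y z).
Proof.
have -> : vsub x z = vadd (vsub x y) (vsub y z).
  by apply: vec_ext => i; rewrite /vadd /vsub; lra.
exact: norm_triangle.
Qed.

Lemma norm_subxx x : norm (vsub x x) = 0.
Proof. by rewrite /norm innerBl !innerBr -sqrt_0; congr sqrt; lra. Qed.

Lemma norm_vzero : norm (vzero : vec k) = 0.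
Proof. by rewrite /norm inner0l sqrt_0. Qed.

Lemma norm_le_add x y : norm x <= norm y + norm (vsub x y).
Proof.
have {1}-> : x = vadd y (vsub x y) by apply: vec_ext => i; rewrite /vadd /vsub; lra.
exact: norm_triangle.
Qed.

Lemma coord_le_norm x i : Rabs (x i) <= norm x.
Proof.
rewrite -(sqrt_Rsqr_abs (x i)); apply: sqrt_le_1_alt; rewrite /Rsqr.
by apply: (vsum_ge_term (f := fun i => x i * x i)) => j; nra.
Qed.

Lemma norm_eq0 x : norm x = 0 -> x = vzero.
Proof.
move=> x0; apply: vec_ext => i; have := coord_le_norm x i.
by rewrite x0 /vzero; have := Rle_abs (x i); have := Rle_abs (- x i); rewrite Rabs_Ropp; lra.
Qed.

Lemma norm_sub_eq0 x y : norm (vsub x y) = 0 -> x = y.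
Proof.
move/norm_eq0 => e; apply: vec_ext => i.
by have := congr1 (fun f => f i) e; rewrite /vsub /vzero; lra.
Qed.

Lemma norm_mono x y : (forall i, Rabs (x i) <= Rabs (y i)) -> norm x <= norm y.
Proof.
move=> xy; apply: sqrt_le_1_alt; apply: le_vsum => i.
by apply: (Rsqr_le_abs_1 (x i) (y i)).
Qed.

Lemma norm_le_vsum x : norm x <= vsum (fun i => Rabs (x i)).
Proof.
have S0 : 0 <= vsum (fun i => Rabs (x i)) by apply: vsum_ge0 => i; apply: Rabs_pos.
apply: norm_le_sq => //.
rewrite -vsumZ; apply: le_vsum => i.
have -> : x i * x i = Rabs (x i) * Rabs (x i) by rewrite -Rabs_mult Rabs_pos_eq //; nra.
apply: Rmult_le_compat_r; first exact: Rabs_pos.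
by apply: (vsum_ge_term (f := fun i => Rabs (x i))) => j; apply: Rabs_pos.
Qed.

End InnerNorm.

Section Concat.
Variables p q : nat.
Implicit Types (a : vec p) (b : vec q) (z : vec (p + q)%N).

Lemma vcat_lshift a b i : vcat a b (lshift q i) = a i.
Proof. by rewrite /vcat (unsplitK (inl i)). Qed.

Lemma vcat_rshift a b j : vcat a b (rshift p j) = b j.
Proof. by rewrite /vcat (unsplitK (inr j)). Qed.

Lemma vl_vcat a b : vl (vcat a b) = a.
Proof. by apply: vec_ext => i; rewrite /vl vcat_lshift. Qed.

Lemma vr_vcat a b : vr (vcat a b) = b.
Proof. by apply: vec_ext => i; rewrite /vr vcat_rshift. Qed.

Lemma vcat_vl_vr z : vcat (vl z) (vr z) = z.
Proof.
by apply: vec_ext => i; rewrite -(splitK i); case: (split i) => j /=;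
  rewrite ?vcat_lshift ?vcat_rshift.
Qed.

Lemma inner_split (x y : vec (p + q)%N) : inner x y = inner (vl x) (vl y) + inner (vr x) (vr y).
Proof. exact: vsum_split. Qed.

Lemma norm_vl z : norm (vl z) <= norm z.
Proof.
apply: norm_le_sq; first exact: norm_ge0.
by rewrite norm_sq (inner_split z); have := inner_ge0 (vr z); lra.
Qed.

Lemma norm_vr z : norm (vr z) <= norm z.
Proof.
apply: norm_le_sq; first exact: norm_ge0.
by rewrite norm_sq (inner_split z); have := inner_ge0 (vl z); lra.
Qed.

Lemma norm_vcat_subl a a' b : norm (vsub (vcat a b) (vcat a' b)) = norm (vsub a a').
Proof.
rewrite /norm inner_split; congr sqrt.
have -> : vl (vsub (vcat a b) (vcat a' b)) = vsub a a'.
  by apply: vec_ext => i; rewrite /vl /vsub !vcat_lshift.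
have -> : vr (vsub (vcat a b) (vcat a' b)) = vzero.
  by apply: vec_ext => i; rewrite /vr /vsub !vcat_rshift /vzero; lra.
by rewrite inner0l; lra.
Qed.

End Concat.

(** * Limits, subsequences and compactness *)

Lemma Un_cvP u l : Un_cv u l <->
  (forall eps, 0 < eps -> exists N : nat, forall j : nat, (N <= j)%N -> Rabs (u j - l) < eps).
Proof.
split=> H eps e0; case: (H eps e0) => N HN; exists N => j; first by move/leP; apply: HN.
by move=> /leP Nj; apply: HN.
Qed.

Lemma Un_cv_const c : Un_cv (fun _ => c) c.
Proof. by apply/Un_cvP => eps e0; exists 0%N => j _; rewrite Rminus_diag Rabs_R0. Qed.

(** Subsequences are encoded throughout as index maps with [j <= sg j]: limits pass to them, and the
    property is preserved by composition. *)
Lemma Un_cv_sub (u : nat -> R) l (sg : nat -> nat) :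
  (forall j, (j <= sg j)%N) -> Un_cv u l -> Un_cv (fun j => u (sg j)) l.
Proof.
move=> sgj /Un_cvP H; apply/Un_cvP => eps /H [N HN].
by exists N => j Nj; apply: HN; apply: leq_trans (sgj j).
Qed.

Lemma eq_Un_cv (u v : nat -> R) l : u =1 v -> Un_cv u l -> Un_cv v l.
Proof.
move=> uv /Un_cvP H; apply/Un_cvP => eps /H [N HN].
by exists N => j /HN; rewrite uv.
Qed.

Lemma Un_cv_squeeze (u v : nat -> R) l :
  (forall j, Rabs (u j - l) <= v j) -> Un_cv v 0 -> Un_cv u l.
Proof.
move=> uv /Un_cvP H; apply/Un_cvP => eps /H [N HN].
exists N => j /HN; rewrite Rminus_0_r => vj; have := uv j; have := Rle_abs (v j); lra.
Qed.

Lemma Un_cv_le_eventually (u : nat -> R) l c :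
  Un_cv u l -> (exists N : nat, forall j, (N <= j)%N -> u j <= c) -> l <= c.
Proof.
move=> /Un_cvP H [N HN]; apply: Rnot_lt_le => cl.
have [|N' HN'] := H (l - c); first lra.
have := HN _ (leq_maxl N N'); have := HN' _ (leq_maxr N N').
by move/Rabs_def2; lra.
Qed.

Lemma vsum_cv k (f : nat -> 'I_k -> R) g :
  (forall i, Un_cv (fun j => f j i) (g i)) -> Un_cv (fun j => vsum (f j)) (vsum g).
Proof.
move=> fg; rewrite /vsum; elim: (enum _) => [|i s IH] /=; first exact: Un_cv_const.
exact: (CV_plus (fun j => f j i) _ (g i) _ (fg i) IH).
Qed.

Definition inv_succ (j : nat) : R := / (INR j + 1).

Lemma inv_succ_gt0 j : 0 < inv_succ j.
Proof. by apply: Rinv_0_lt_compat; have := pos_INR j; lra. Qed.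

Lemma inv_succ_cv : Un_cv inv_succ 0.
Proof.
apply/Un_cvP => eps e0; have [N [HN N0]] := archimed_cor1 eps e0.
exists N => j Nj; rewrite Rminus_0_r Rabs_pos_eq; last by have := inv_succ_gt0 j; lra.
apply: Rle_lt_trans HN; apply: Rinv_le_contravar.
  by apply: lt_0_INR.
by have := le_INR _ _ (elimT leP Nj); lra.
Qed.

Section Convergence.
Variable k : nat.
Implicit Types (s t : nat -> vec k) (l a b : vec k).

Lemma vcv_norm s l : vcv s l <-> Un_cv (fun j => norm (vsub (s j) l)) 0.
Proof.
have E j : Rabs (norm (vsub (s j) l) - 0) = norm (vsub (s j) l).
  by rewrite Rminus_0_r Rabs_pos_eq //; apply: norm_ge0.
split=> [H|/Un_cvP H]; first apply/Un_cvP => eps e0; last move=> eps e0.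
  by have [N HN] := H eps e0; exists N => j; rewrite E; apply: HN.
by have [N HN] := H eps e0; exists N => j; rewrite -E; apply: HN.
Qed.

Lemma vcv_coord s l : vcv s l <-> forall i, Un_cv (fun j => s j i) (l i).
Proof.
split=> [/vcv_norm H i|H].
  apply: Un_cv_squeeze H => j; exact: (coord_le_norm (vsub (s j) l) i).
apply/vcv_norm.
have H0 : Un_cv (fun j => vsum (fun i => Rabs (s j i - l i))) 0.
  rewrite -(vsum_const0 k); apply: vsum_cv => i; apply/Un_cvP => eps e0.
  have /Un_cvP H1 := H i; have [N HN] := H1 eps e0.
  by exists N => j /HN; rewrite Rminus_0_r Rabs_Rabsolu.
apply: Un_cv_squeeze H0 => j; rewrite Rminus_0_r Rabs_pos_eq; last exact: norm_ge0.
exact: norm_le_vsum.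
Qed.

Lemma vcv_const l : vcv (fun _ => l) l.
Proof. by apply/vcv_coord => i; apply: Un_cv_const. Qed.

Lemma eq_vcv s t l : (forall j, s j = t j) -> vcv s l -> vcv t l.
Proof. by move=> st H eps /H [N HN]; exists N => j /HN; rewrite st. Qed.

Lemma vcv_sub s l sg : (forall j, (j <= sg j)%N) -> vcv s l -> vcv (fun j => s (sg j)) l.
Proof.
by move=> sgj H eps /H [N HN]; exists N => j Nj; apply: HN; apply: leq_trans (sgj j).
Qed.

Lemma vcv_scale (u : nat -> R) r t b :
  Un_cv u r -> vcv t b -> vcv (fun j => vscale (u j) (t j)) (vscale r b).
Proof.
move=> H1 /vcv_coord H2; apply/vcv_coord => i.
exact: (CV_mult u (fun j => t j i)).
Qed.

Lemma vcv_vsub s t a b : vcv s a -> vcv t b -> vcv (fun j => vsub (s j) (t j)) (vsub a b).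
Proof.
move=> /vcv_coord H1 /vcv_coord H2; apply/vcv_coord => i.
exact: (CV_minus (fun j => s j i) (fun j => t j i)).
Qed.

Lemma inner_cv s t a b : vcv s a -> vcv t b -> Un_cv (fun j => inner (s j) (t j)) (inner a b).
Proof.
move=> /vcv_coord H1 /vcv_coord H2; apply: vsum_cv => i.
exact: (CV_mult (fun j => s j i) (fun j => t j i)).
Qed.

Lemma norm_cv s a : vcv s a -> Un_cv (fun j => norm (s j)) (norm a).
Proof.
move/vcv_norm; apply: Un_cv_squeeze => j; apply: Rabs_le.
have := norm_le_add (s j) a; have := norm_le_add a (s j); rewrite norm_subC; lra.
Qed.

Lemma vcv_near s t l : vcv s l -> Un_cv (fun j => norm (vsub (t j) (s j))) 0 -> vcv t l.
Proof.
move=> /vcv_norm H1 H2; apply/vcv_norm.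
have := CV_plus _ _ _ _ H2 H1; rewrite Rplus_0_r; apply: Un_cv_squeeze => j.
rewrite Rminus_0_r Rabs_pos_eq; last exact: norm_ge0.
exact: norm_sub_triangle.
Qed.

Lemma vcv_unique s a b : vcv s a -> vcv s b -> a = b.
Proof.
move=> /vcv_coord H1 /vcv_coord H2; apply: vec_ext => i; exact: UL_sequence (H1 i) (H2 i).
Qed.

End Convergence.

Lemma vcv_cat p q (s : nat -> vec p) (t : nat -> vec q) a b :
  vcv s a -> vcv t b -> vcv (fun j => vcat (s j) (t j)) (vcat a b).
Proof.
move=> /vcv_coord H1 /vcv_coord H2; apply/vcv_coord => i; rewrite -(splitK i).
case: (split i) => i' /=; rewrite ?vcat_lshift ?vcat_rshift.
  by apply: eq_Un_cv (H1 i') => j; rewrite vcat_lshift.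
by apply: eq_Un_cv (H2 i') => j; rewrite vcat_rshift.
Qed.

Lemma vcv_vl p q (s : nat -> vec (p + q)%N) a : vcv s a -> vcv (fun j => vl (s j)) (vl a).
Proof. by move=> /vcv_coord H; apply/vcv_coord => i; apply: H. Qed.

Lemma vcv_vr p q (s : nat -> vec (p + q)%N) a : vcv s a -> vcv (fun j => vr (s j)) (vr a).
Proof. by move=> /vcv_coord H; apply/vcv_coord => i; apply: H. Qed.

Lemma real_bolzano_weierstrass (u : nat -> R) C : (forall j, Rabs (u j) <= C) ->
  exists sg l, (forall j, (j <= sg j)%N) /\ Un_cv (fun j => u (sg j)) l.
Proof.
move=> uC.
have [l Hl] : exists l, ValAdh u l.
  apply: (Bolzano_Weierstrass u (fun c => - C <= c <= C)); first exact: compact_P3.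
  move=> j; have := uC j; have := Rle_abs (u j); have := Rle_abs (- u j).
  by rewrite Rabs_Ropp; lra.
have /functional_choice [sg Hsg] : forall j : nat, exists i : nat,
    (j <= i)%N /\ Rabs (u i - l) < inv_succ j.
  move=> j; have [|i [ji Hi]] := Hl (disc l (mkposreal _ (inv_succ_gt0 j))) j.
    by exists (mkposreal _ (inv_succ_gt0 j)) => x.
  by exists i; split; [apply/leP | exact: Hi].
exists sg, l; split=> [j|]; first by case: (Hsg j).
apply: Un_cv_squeeze inv_succ_cv => j; by case: (Hsg j) => _ /Rlt_le.
Qed.

Lemma bolzano_weierstrass k (s : nat -> vec k) C : (forall j, norm (s j) <= C) ->
  exists sg l, (forall j, (j <= sg j)%N) /\ vcv (fun j => s (sg j)) l.
Proof.
move=> sC.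
(* Induction over a list of coordinates: each step refines the subsequence so that one more
   coordinate converges, the earlier ones keeping their limits. *)
suff H : forall r : seq 'I_k, exists sg, (forall j, (j <= sg j)%N) /\
    forall i, i \in r -> exists l, Un_cv (fun j => s (sg j) i) l.
  have [sg [sgj Hsg]] := H (enum 'I_k).
  have /functional_choice [l Hl] : forall i, exists l, Un_cv (fun j => s (sg j) i) l.
    by move=> i; apply: Hsg; rewrite mem_enum.
  by exists sg, l; split=> //; apply/vcv_coord.
elim=> [|i r [sg [sgj Hsg]]]; first by exists id.
have [j|sg' [l [sgj' Hl]]] := @real_bolzano_weierstrass (fun j => s (sg j) i) C.
  exact: Rle_trans (coord_le_norm _ _) (sC _).
exists (fun j => sg (sg' j)); split=> [j|i'].
  exact: leq_trans (sgj' j) (sgj _).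
rewrite inE => /orP [/eqP ->|/Hsg [l' Hl']]; first by exists l.
by exists l'; apply: (Un_cv_sub sgj' Hl').
Qed.

(** The dichotomy behind the limit passages with multipliers: qualification conditions serve to
    exclude the second case. If no bound holds infinitely often, the norms exceed every level, and
    dividing by them leaves unit vectors, which have a convergent subsequence. *)
Lemma bounded_or_blowup k (v : nat -> vec k) :
  (exists sg l, (forall j, (j <= sg j)%N) /\ vcv (fun j => v (sg j)) l) \/
  (exists sg l lam, [/\ forall j, (j <= sg j)%N, forall j, 0 < lam j, Un_cv lam 0,
     vcv (fun j => vscale (lam j) (v (sg j))) l & norm l = 1]).
Proof.
case: (classic (exists C, forall N : nat, exists j : nat, (N <= j)%N /\ norm (v j) <= C)).
  case=> C /functional_choice [sg Hsg]; left.
  have [j|sg' [l [sgj' Hl]]] := @bolzano_weierstrass k (fun j => v (sg j)) C.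
    by case: (Hsg j).
  exists (fun j => sg (sg' j)), l; split=> // j.
  by apply: leq_trans (sgj' j) _; case: (Hsg (sg' j)).
move=> nb; right.
have /functional_choice [sg Hsg] : forall j : nat, exists i : nat,
    (j <= i)%N /\ INR j + 1 < norm (v i).
  move=> j; apply: NNPP => H; apply: nb; exists (INR j + 1) => N.
  exists (maxn j N); split; first exact: leq_maxr.
  by apply: Rnot_lt_le => H'; apply: H; exists (maxn j N); rewrite leq_maxl.
have n0 j : 0 < norm (v (sg j)) by case: (Hsg j) => _; have := pos_INR j; lra.
pose lam j := / norm (v (sg j)).
have lam0 j : 0 < lam j by apply: Rinv_0_lt_compat.
have u1 j : norm (vscale (lam j) (v (sg j))) = 1.
  by rewrite norm_scale Rabs_pos_eq; [rewrite /lam; field; have := n0 j; lra | have := lam0 j; lra].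
have [j|sg' [l [sgj' Hl]]] := @bolzano_weierstrass k (fun j => vscale (lam j) (v (sg j))) 1.
  by rewrite u1; lra.
exists (fun j => sg (sg' j)), l, (fun j => lam (sg' j)); split=> //.
- by move=> j; apply: leq_trans (sgj' j) _; case: (Hsg (sg' j)).
- apply: Un_cv_sub sgj' _; apply: Un_cv_squeeze inv_succ_cv => j.
  rewrite Rminus_0_r Rabs_pos_eq; last by have := lam0 j; lra.
  apply: Rinv_le_contravar; first by have := pos_INR j; lra.
  by case: (Hsg j) => _; lra.
- have := norm_cv Hl; under [X in Un_cv X]functional_extensionality => j do rewrite u1.
  by move=> H; apply: UL_sequence H (Un_cv_const 1).
Qed.

(** * Lower semicontinuous functions and differentiability *)

Lemma lt_Rmin a b c : a < Rmin b c -> a < b /\ a < c.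
Proof. exact: Rmin_Rgt_l. Qed.

Lemma le_Rmin a b c : a <= Rmin b c -> a <= b /\ a <= c.
Proof. by have := Rmin_l b c; have := Rmin_r b c; split; lra. Qed.

Lemma Un_cv_ge_eventually (u : nat -> R) l c :
  Un_cv u l -> (exists N : nat, forall j, (N <= j)%N -> c <= u j) -> c <= l.
Proof.
move=> /CV_opp ul [N HN]; have : - l <= - c; last by lra.
by apply: Un_cv_le_eventually ul _; exists N => j /HN; rewrite /opp_seq; lra.
Qed.

Definition eadd (a : option R) (r : R) : option R :=
  if a is Some x then Some (x + r) else None.

Lemma egt_ege a r : egt a r -> ege a r.
Proof. by case: a => //= x; lra. Qed.

Lemma ege_trans a r r' : r <= r' -> ege a r' -> ege a r.
Proof. by case: a => //= x; lra. Qed.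

Lemma lsc_seq k (f : vec k -> option R) s l r : lsc_fun f -> vcv s l -> egt (f l) r ->
  exists N : nat, forall j : nat, (N <= j)%N -> egt (f (s j)) r.
Proof.
move=> fl sl /fl [del [d0 H]]; have [N HN] := sl del d0.
by exists N => j /HN; apply: H.
Qed.

Lemma lsc_seq_eadd k (f : vec k -> option R) s l u v r : lsc_fun f -> vcv s l ->
  Un_cv u v -> egt (eadd (f l) v) r ->
  exists N : nat, forall j : nat, (N <= j)%N -> egt (eadd (f (s j)) (u j)) r.
Proof.
move=> fl sl /Un_cvP uv H.
have [dl [d0 Hd]] : exists dl, 0 < dl /\ egt (f l) (r - v + dl).
  case: (f l) H => /= [a|_]; last by exists 1; split=> //; lra.
  by move=> H; exists ((a + v - r) / 2); lra.
have [N HN] := lsc_seq fl sl Hd; have [N' HN'] := uv dl d0.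
exists (maxn N N') => j; rewrite geq_max => /andP [/HN + /HN' /Rabs_def2].
by case: (f (s j)) => //= x; lra.
Qed.

(** Weierstrass' theorem, with compactness of [K] and lower semicontinuity of [g] merged into one
    hypothesis on sequences. This allows [T] to be a product of vector spaces. *)
Lemma ext_min (T : Type) (K : T -> Prop) (g : T -> option R) t0 a0 :
  (forall s : nat -> T, (forall j, K (s j)) -> exists sg t, [/\ K t,
     forall j, (j <= sg j)%N &
     forall r, egt (g t) r -> exists N : nat, forall j, (N <= j)%N -> egt (g (s (sg j))) r]) ->
  K t0 -> g t0 = Some a0 ->
  exists t a, [/\ K t, g t = Some a & forall t', K t' -> ege (g t') a].
Proof.
move=> Kc Kt0 gt0.
pose LB r := forall t, K t -> ege (g t) r.
have notLB r : ~ LB r -> exists t, K t /\ ~ ege (g t) r.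
  move=> H; apply: NNPP => H'; apply: H => t Kt; apply: NNPP => H; apply: H'; by exists t.
have [r0 LB0] : exists r, LB r.
  apply: NNPP => H.
  have /functional_choice [s Hs] : forall j : nat, exists t, K t /\ ~ ege (g t) (- INR j).
    by move=> j; apply: notLB => H'; apply: H; exists (- INR j).
  have [j|sg [t [Kt sgj Ht]]] := Kc s; first by case: (Hs j).
  (* Any level strictly below [g t]; 0 serves when [g t] is infinite. *)
  pose r := if g t is Some a then a - 1 else 0.
  have [|N HN] := Ht r; first by rewrite /r; case: (g t) => //= x; lra.
  have [M HM] := INR_unbounded (- r).
  have := HN _ (leq_maxl N M); case: (Hs (sg (maxn N M))) => _ + H'; apply.
  apply: ege_trans (egt_ege H').
  have : INR M <= INR (sg (maxn N M)).
    by apply/le_INR/leP; apply: leq_trans (leq_maxr N M) (sgj _).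
  lra.
have LBa r : LB r -> r <= a0 by move=> /(_ t0 Kt0); rewrite gt0.
have [m [mub mlub]] : {m | is_lub LB m}.
  by apply: completeness; [exists a0 => r; apply: LBa | exists r0].
have LBm : LB m.
  move=> t Kt; case E: (g t) => [a|] //=; apply: mlub => r /(_ t Kt); by rewrite E.
have /functional_choice [s Hs] : forall j : nat, exists t, K t /\ ~ ege (g t) (m + inv_succ j).
  by move=> j; apply: notLB => /mub; have := inv_succ_gt0 j; lra.
have [j|sg [t [Kt sgj Ht]]] := Kc s; first by case: (Hs j).
(* The values along the minimising sequence fall below every [m + eps], so lower semicontinuity
   leaves [g t] no room above [m]; in particular it is finite. *)
have H eps : 0 < eps -> ~ egt (g t) (m + eps).
  move=> e0 /Ht [N HN].
  have /Un_cvP /(_ eps e0) [M HM] := inv_succ_cv.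
  have := HN _ (leq_maxl N M); case: (Hs (sg (maxn N M))) => _ + H'; apply.
  apply: ege_trans (egt_ege H').
  have := HM _ (leq_trans (leq_maxr N M) (sgj _)); move/Rabs_def2; lra.
exists t; case E: (g t) H => [a|] /= H; last by case: (H 1); first lra.
exists a; split=> // t' /LBm; apply: ege_trans.
apply: Rnot_lt_le => ma; case: (H ((a - m) / 2)); lra.
Qed.

Section Differentiability.
Variable N : nat.
Implicit Types (F G : vec N -> R) (z g : vec N).

Definition fdiff F z g : Prop :=
  forall eps, 0 < eps -> exists del, 0 < del /\ forall z', norm (vsub z' z) < del ->
    Rabs (F z' - F z - inner g (vsub z' z)) <= eps * norm (vsub z' z).

Lemma fdiff_calm F z g : fdiff F z g -> exists C del, [/\ 0 < C, 0 < del &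
  forall z', norm (vsub z' z) < del -> Rabs (F z' - F z) <= C * norm (vsub z' z)].
Proof.
move=> /(_ 1 Rlt_0_1) [del [d0 H]]; exists (norm g + 1), del; split=> //.
  by have := norm_ge0 g; lra.
move=> z' /H H1; have := cauchy_schwarz_abs g (vsub z' z).
have := Rabs_triang (F z' - F z - inner g (vsub z' z)) (inner g (vsub z' z)).
have -> : F z' - F z - inner g (vsub z' z) + inner g (vsub z' z) = F z' - F z by lra.
lra.
Qed.

Lemma eq_fdiff F G z g g' : F =1 G -> g = g' -> fdiff F z g -> fdiff G z g'.
Proof.
move=> FG <- H eps /H [del [d0 Hd]]; exists del; split=> // z' /Hd.
by rewrite !FG.
Qed.

Lemma fdiff_const c z : fdiff (fun _ => c) z vzero.
Proof.
move=> eps e0; exists 1; split=> [|z' _]; first lra.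
rewrite inner0l (_ : c - c - 0 = 0); last lra.
by rewrite Rabs_R0; have := norm_ge0 (vsub z' z); nra.
Qed.

Lemma fdiff_coord i z : fdiff (fun z' => z' i) z (ebasis i).
Proof.
move=> eps e0; exists 1; split=> [|z' _]; first lra.
rewrite inner_ebasis /vsub (_ : z' i - z i - (z' i - z i) = 0); last lra.
by rewrite Rabs_R0; have := norm_ge0 (vsub z' z); rewrite /vsub; nra.
Qed.

Lemma fdiff_add F G z g g' :
  fdiff F z g -> fdiff G z g' -> fdiff (fun z' => F z' + G z') z (vadd g g').
Proof.
move=> HF HG eps e0.
have [|d1 [d10 H1]] := HF (eps / 2); first lra.
have [|d2 [d20 H2]] := HG (eps / 2); first lra.
exists (Rmin d1 d2); split=> [|z' /lt_Rmin [/H1 {}H1 /H2 {}H2]]; first exact: Rmin_glb_lt.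
rewrite innerDl.
have := Rabs_triang (F z' - F z - inner g (vsub z' z)) (G z' - G z - inner g' (vsub z' z)).
set X := Rabs (_ + _); set Y := Rabs (_ - (_ + _)).
have -> : Y = X by congr Rabs; lra.
lra.
Qed.

Lemma fdiff_scale c F z g : fdiff F z g -> fdiff (fun z' => c * F z') z (vscale c g).
Proof.
move=> HF eps e0; have c0 := Rabs_pos c.
(* The [+ 1] covers [c = 0]. *)
have [|d [d0 H]] := HF (eps / (Rabs c + 1)); first by apply: Rdiv_lt_0_compat; lra.
exists d; split=> // z' /H {}H; rewrite innerZl.
have -> : c * F z' - c * F z - c * inner g (vsub z' z) =
  c * (F z' - F z - inner g (vsub z' z)) by lra.
rewrite Rabs_mult.
apply: Rle_trans (_ : (Rabs c + 1) * (eps / (Rabs c + 1) * norm (vsub z' z)) <= _).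
  apply: Rmult_le_compat => //; [exact: Rabs_pos | lra].
by apply: Req_le; field; lra.
Qed.

Lemma fdiff_mul F G z g g' : fdiff F z g -> fdiff G z g' ->
  fdiff (fun z' => F z' * G z') z (vadd (vscale (G z) g) (vscale (F z) g')).
Proof.
move=> HF HG eps e0.
have [C1 [c1 [C10 c10 K1]]] := fdiff_calm HF; have [C2 [c2 [C20 c20 K2]]] := fdiff_calm HG.
have [|d1 [d10 H1]] := fdiff_scale (G z) HF (eps := eps / 3); first lra.
have [|d2 [d20 H2]] := fdiff_scale (F z) HG (eps := eps / 3); first lra.
have C12 : 0 < C1 * C2 by apply: Rmult_lt_0_compat.
(* Within [d3] the product of the two increments, at most [C1 n * C2 n], is at most [eps / 3 * n];
   the other two thirds go to the linear parts. *)
pose d3 := eps / 3 / (C1 * C2).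
have d30 : 0 < d3 by apply: Rdiv_lt_0_compat; lra.
exists (Rmin (Rmin c1 c2) (Rmin d3 (Rmin d1 d2))); split; first by do !apply: Rmin_glb_lt.
move=> z' /lt_Rmin [/lt_Rmin [/K1 {}K1 /K2 {}K2] /lt_Rmin [n3 /lt_Rmin [/H1 {}H1 /H2 {}H2]]].
have n0 := norm_ge0 (vsub z' z); set n := norm _ in n0 n3 H1 H2 K1 K2 *.
have P : Rabs ((F z' - F z) * (G z' - G z)) <= eps / 3 * n.
  rewrite Rabs_mult.
  apply: Rle_trans (_ : (C1 * n) * (C2 * n) <= _).
    by apply: Rmult_le_compat => //; apply: Rabs_pos.
  have -> : C1 * n * (C2 * n) = (C1 * C2 * n) * n by lra.
  apply: Rmult_le_compat_r => //.
  have -> : eps / 3 = C1 * C2 * d3 by rewrite /d3; field; lra.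
  by apply: Rmult_le_compat_l; lra.
rewrite innerDl.
set i1 := inner _ _ in H1 *; set i2 := inner _ _ in H2 *.
have -> : F z' * G z' - F z * G z - (i1 + i2) =
  (G z * F z' - G z * F z - i1) + (F z * G z' - F z * G z - i2) +
  ((F z' - F z) * (G z' - G z)) by lra.
apply: Rle_trans (Rabs_triang _ _) _.
have := Rabs_triang (G z * F z' - G z * F z - i1) (F z * G z' - F z * G z - i2).
lra.
Qed.

Lemma fdiff_vsum k (F : 'I_k -> vec N -> R) z (g : 'I_k -> vec N) :
  (forall i, fdiff (F i) z (g i)) ->
  fdiff (fun z' => vsum (fun i => F i z')) z (fun j => vsum (fun i => g i j)).
Proof.
move=> H; rewrite /vsum; elim: (enum _) => [|i s IH] /=; first exact: fdiff_const.
exact: (fdiff_add (H i) IH).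
Qed.

End Differentiability.

Lemma fdiff_vl p q (F : vec p -> R) (z : vec (p + q)%N) g :
  fdiff F (vl z) g -> fdiff (fun z' : vec (p + q)%N => F (vl z')) z (vcat g vzero).
Proof.
move=> H eps e0; have [del [d0 Hd]] := H eps e0; exists del; split=> // z' n.
have n' : norm (vsub (vl z') (vl z)) <= norm (vsub z' z) := norm_vl (vsub z' z).
have := Hd (vl z'); rewrite inner_split vl_vcat vr_vcat inner0l Rplus_0_r => Hz.
apply: Rle_trans (Hz _) _; first lra.
by apply: Rmult_le_compat_l; lra.
Qed.

Lemma fdiff_vcatl p q (F : vec (p + q)%N -> R) x w g :
  fdiff F (vcat x w) g -> fdiff (fun x' => F (vcat x' w)) x (vl g).
Proof.
move=> H eps e0; have [del [d0 Hd]] := H eps e0; exists del; split=> // x' n.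
have El : vl (vsub (vcat x' w) (vcat x w)) = vsub x' x.
  by apply: vec_ext => i; rewrite /vl /vsub !vcat_lshift.
have Er : vr (vsub (vcat x' w) (vcat x w)) = vzero.
  by apply: vec_ext => i; rewrite /vr /vsub !vcat_rshift /vzero; lra.
have := Hd (vcat x' w); rewrite norm_vcat_subl => /(_ n).
by rewrite inner_split El Er (innerC (vr g)) inner0l Rplus_0_r.
Qed.

Lemma mean_value (f f' : R -> R) a : (forall t, derivable_pt_lim f t (f' t)) ->
  exists c, Rabs c <= Rabs a /\ f a - f 0 = f' c * a.
Proof.
move=> H; case: (Rtotal_order a 0) => [a0|[a0|a0]].
- have [c [E cI]] := MVT_cor2 f f' a 0 a0 (fun c _ => H c).
  by exists c; split; [rewrite !Rabs_left; lra | lra].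
- by exists 0; split; rewrite a0; lra.
- have [c [E cI]] := MVT_cor2 f f' 0 a a0 (fun c _ => H c).
  by exists c; split; [rewrite !Rabs_right; lra | lra].
Qed.

(* The increment is telescoped through the points that agree with [z'] on the first [k]
   coordinates and with [z] on the others; each step is a one-variable mean value theorem. *)
Lemma C1_fdiff N (F : vec N -> R) (G : 'I_N -> vec N -> R) :
  (forall i, has_pderiv F i (G i)) -> (forall i, vcont (G i)) ->
  forall z, fdiff F z (fun i => G i z).
Proof.
move=> HF HG z.
pose mix k z' : vec N := fun i => if (i < k)%N then z' i else z i.
pose S k z' := vsum (fun i : 'I_N => if (i < k)%N then G i z * (z' i - z i) else 0).
suff H k : (k <= N)%N -> forall eps, 0 < eps -> exists del, 0 < del /\
    forall z', norm (vsub z' z) < del ->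
    Rabs (F (mix k z') - F z - S k z') <= eps * norm (vsub z' z).
  move=> eps e0; have [del [d0 Hd]] := H N (leqnn N) eps e0.
  exists del; split=> // z' /Hd.
  have -> : mix N z' = z' by apply: vec_ext => i; rewrite /mix ltn_ord.
  have -> // : S N z' = inner (fun i => G i z) (vsub z' z).
  by apply: eq_vsum => i; rewrite ltn_ord.
elim: k => [|k IH] kN eps e0.
  exists 1; split=> [|z' _]; first lra.
  have -> : mix 0%N z' = z by apply: vec_ext => i; rewrite /mix ltn0.
  have -> : S 0%N z' = 0 by rewrite -(vsum_const0 N); apply: eq_vsum => i; rewrite ltn0.
  rewrite (_ : F z - F z - 0 = 0); last lra.
  by rewrite Rabs_R0; have := norm_ge0 (vsub z' z); nra.
have [||d1 [d10 H1]] := IH _ (eps / 2); [exact: ltnW | lra |].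
pose i0 := Ordinal kN.
have [|d2 [d20 H2]] := HG i0 z (eps / 2); first lra.
exists (Rmin d1 d2); split=> [|z' /lt_Rmin [/H1 {}H1 n2]]; first exact: Rmin_glb_lt.
pose a := z' i0 - z i0.
pose f t := F (vadd (mix k z') (vscale t (ebasis i0))).
pose f' t := G i0 (vadd (mix k z') (vscale t (ebasis i0))).
have Hf t : derivable_pt_lim f t (f' t).
  move=> e e0'.
  have [dl Hdl] := HF i0 (vadd (mix k z') (vscale t (ebasis i0))) e e0'.
  exists dl => h h0 hd; have := Hdl h h0 hd.
  have vE s : vadd (vadd (mix k z') (vscale t (ebasis i0))) (vscale s (ebasis i0)) =
     vadd (mix k z') (vscale (t + s) (ebasis i0)).
    by apply: vec_ext => i; rewrite /vadd /vscale; lra.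
  by rewrite !vE Rplus_0_l Rplus_0_r.
have [c [ca E]] := mean_value a Hf; rewrite /f /f' in E.
have M1 : vadd (mix k z') (vscale a (ebasis i0)) = mix k.+1 z'.
  apply: vec_ext => i; rewrite /vadd /vscale /ebasis /mix ltnS.
  case: (eqVneq i i0) => [->|ne]; first by rewrite /= ltnn leqnn /a; lra.
  by rewrite -(inj_eq val_inj) /= in ne; rewrite (leq_eqVlt i) (negbTE ne) /=; lra.
have M0 : vadd (mix k z') (vscale 0 (ebasis i0)) = mix k z'.
  by apply: vec_ext => i; rewrite /vadd /vscale; lra.
rewrite M1 M0 in E.
have SE : S k.+1 z' = S k z' + G i0 z * a.
  rewrite -(vsum_delta (fun i => G i z * (z' i - z i)) i0) /S -vsumD.
  apply: eq_vsum => i; rewrite /ebasis ltnS.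
  case: (eqVneq i i0) => [->|ne]; first by rewrite /= ltnn leqnn; lra.
  by rewrite -(inj_eq val_inj) /= in ne; rewrite (leq_eqVlt i) (negbTE ne) /=; lra.
have an : Rabs a <= norm (vsub z' z) := coord_le_norm (vsub z' z) i0.
(* The mean value point is, coordinate by coordinate, no farther from [z] than [z'] is, so
   continuity of [G i0] at [z] applies. *)
have Gc : Rabs (G i0 (vadd (mix k z') (vscale c (ebasis i0))) - G i0 z) < eps / 2.
  apply: H2; apply: Rle_lt_trans n2; apply: norm_mono => i.
  rewrite /vsub /vadd /vscale /ebasis /mix.
  case: (eqVneq i i0) => [->|ne] /=.
    by rewrite ltnn (_ : z i0 + c * 1 - z i0 = c) //; lra.
  case: ifP => _; first by apply: Req_le; congr Rabs; lra.
  rewrite (_ : z i + c * 0 - z i = 0); last lra.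
  by rewrite Rabs_R0; apply: Rabs_pos.
set g' := G i0 (vadd _ _) in E Gc.
have -> : F (mix k.+1 z') - F z - S k.+1 z' =
  (F (mix k z') - F z - S k z') + (g' - G i0 z) * a by rewrite SE; lra.
apply: Rle_trans (Rabs_triang _ _) _; rewrite Rabs_mult.
have : Rabs (g' - G i0 z) * Rabs a <= eps / 2 * norm (vsub z' z).
  by apply: Rmult_le_compat; (try exact: Rabs_pos); lra.
lra.
Qed.

Lemma vcont_seq N (F : vec N -> R) s z : vcont F -> vcv s z -> Un_cv (fun j => F (s j)) (F z).
Proof.
move=> HF sz; apply/Un_cvP => eps e0; have [del [d0 Hd]] := HF z eps e0.
by have [M HM] := sz del d0; exists M => j /HM; apply: Hd.
Qed.

(* [J] is the adjoint of the derivative of [Psi] at [x]. *)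
Definition adiff p q (Psi : vec p -> vec q) (x : vec p) (J : vec q -> vec p) : Prop :=
  forall v, fdiff (fun x' => inner v (Psi x')) x (J v).

Section AdjointDifferentiability.
Variables p q : nat.
Variables (Psi : vec p -> vec q) (x : vec p) (J : vec q -> vec p).
Hypothesis HJ : adiff Psi x J.

(** Taking basis vectors for [v] makes each coordinate of [Psi] calm; the constants are added up by
    induction over the list of coordinates. *)
Lemma adiff_calm : exists C del, [/\ 0 < C, 0 < del & forall x', norm (vsub x' x) < del ->
  norm (vsub (Psi x') (Psi x)) <= C * norm (vsub x' x)].
Proof.
suff [C [del [C0 d0 H]]] : exists C del, [/\ 0 < C, 0 < del & forall x',
    norm (vsub x' x) < del ->
    vsum (fun i => Rabs (vsub (Psi x') (Psi x) i)) <= C * norm (vsub x' x)].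
  by exists C, del; split=> // x' /H; apply: Rle_trans; apply: norm_le_vsum.
rewrite /vsum; elim: (enum _) => [|i s [C [del [C0 d0 H]]]] /=.
  exists 1, 1; split; try lra; move=> x' _; have := norm_ge0 (vsub x' x); lra.
have [C' [del' [C0' d0' H']]] := fdiff_calm (HJ (ebasis i)).
exists (C' + C), (Rmin del' del); split; [lra | exact: Rmin_glb_lt |].
move=> x' /lt_Rmin [/H' + /H]; rewrite !inner_ebasis /vsub; lra.
Qed.

Lemma adiff_continuous s : vcv s x -> vcv (fun j => Psi (s j)) (Psi x).
Proof.
have [C [del [C0 d0 H]]] := adiff_calm.
move=> sx eps e0; have [|N HN] := sx (Rmin del (eps / C)).
  by apply: Rmin_glb_lt => //; apply: Rdiv_lt_0_compat.
exists N => j /HN /lt_Rmin [/H {}H n]; apply: Rle_lt_trans H _.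
have -> : eps = C * (eps / C) by field; lra.
exact: Rmult_lt_compat_l.
Qed.

End AdjointDifferentiability.

(** * The fuzzy chain rule *)

Lemma inner_subxx k (y x : vec k) : inner y (vsub x x) = 0.
Proof. rewrite innerBr; lra. Qed.

Lemma inner_sub_expand k (b a c : vec k) :
  inner (vsub a c) (vsub a c) =
  inner (vsub b c) (vsub b c) + 2 * inner (vsub b c) (vsub a b) + inner (vsub a b) (vsub a b).
Proof.
rewrite !innerBl !innerBr (innerC b a) (innerC c a) (innerC c b); lra.
Qed.

(** Test the inequality with a small negative multiple of [w]. *)
Lemma norm_le_of_variation k (w : vec k) c r : 0 <= c -> 0 < r ->
  (forall e, norm e < r -> 0 <= inner w e + c * norm e) -> norm w <= c.
Proof.
move=> c0 r0 H; have n0 := norm_ge0 w.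
(* Ensures [t * |w| < r], and the [+ 1] keeps the denominator positive when [w] is zero. *)
pose t := r / (2 * (norm w + 1)).
have t0 : 0 < t by apply: Rdiv_lt_0_compat; lra.
have tE : t * (norm w + 1) = r / 2 by rewrite /t; field; lra.
have := H (vscale (- t) w).
rewrite norm_scale innerZr Rabs_Ropp Rabs_pos_eq; last lra.
rewrite -norm_sq => H'; have {}H' : 0 <= - t * (norm w * norm w) + c * (t * norm w).
  by apply: H'; nra.
apply: Rnot_lt_le => cw.
have : 0 < t * norm w by apply: Rmult_lt_0_compat; lra.
by nra.
Qed.

(* Fermat's rule for [f] plus a quadratic. *)
Lemma rsubdiff_quadratic_min k (f : vec k -> option R) z a c e M r :
  f z = Some a -> 0 < r -> 0 <= M ->
  (forall z', norm (vsub z' z) < r ->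
     ege (f z') (a + inner c (vsub z' z)
        - M * (inner (vsub z' e) (vsub z' e) - inner (vsub z e) (vsub z e)))) ->
  rsubdiff f z (vsub c (vscale (2 * M) (vsub z e))).
Proof.
move=> fz r0 M0 H; exists a; split=> // eps e0.
exists (Rmin r (eps / (M + 1))); split.
  by apply: Rmin_glb_lt => //; apply: Rdiv_lt_0_compat; lra.
move=> z' [n0 /lt_Rmin [n1 n2]]; apply: ege_trans (H z' n1).
rewrite (inner_sub_expand z) innerBl innerZl -(norm_sq (vsub z' z)).
have E : eps / (M + 1) * (M + 1) = eps by field; lra.
set n := norm _ in n0 n1 n2 *.
have : n * (M + 1) <= eps by rewrite -E; apply: Rmult_le_compat_r; lra.
by nra.
Qed.

Lemma small_square_le C eps n : 0 <= C -> 0 < eps -> 0 <= n -> n < eps / (C + 1) ->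
  C * (n * n) <= eps * n.
Proof.
move=> C0 e0 n0 n1; have E : eps / (C + 1) * (C + 1) = eps by field; lra.
have : n * (C + 1) <= eps by rewrite -E; apply: Rmult_le_compat_r; lra.
by nra.
Qed.

(** [rsubdiff] leaves out [x' = x]; the bound is an equality there, so it may be used at minimisers
    without a case split. *)
Lemma rsubdiff_at p (psi : vec p -> option R) x v b eps :
  rsubdiff psi x v -> psi x = Some b -> 0 < eps -> exists del, 0 < del /\
  forall x', norm (vsub x' x) < del ->
    ege (psi x') (b + inner v (vsub x' x) - eps * norm (vsub x' x)).
Proof.
move=> [b' [E' H]]; rewrite E' => -[<-] /H [del [d0 Hd]]; exists del; split=> // x' n.
case: (Rle_lt_or_eq_dec _ _ (norm_ge0 (vsub x' x))) => n0; first exact: Hd.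
rewrite (norm_sub_eq0 (esym n0)) E' norm_subxx inner_subxx /=.
lra.
Qed.

Section FuzzyChainRule.
Variables p q : nat.
Variables (f : vec q -> option R) (Psi : vec p -> vec q) (J : vec p -> vec q -> vec p).
Hypothesis f_lsc : lsc_fun f.
Hypothesis HJ : forall x, adiff Psi x (J x).

(* Decouple [f (Psi x)] into [f z] with penalty [M |Psi x - z|^2]: minimisers converge to
   [(xb, Psi xb)] as [M] grows, and Fermat's rule in [z] and in [x] at one of them gives the
   subgradient [v = 2 M (Psi x - z)] and the estimate on [J x v]. *)
Lemma fuzzy_chain_rule xb y eps : rsubdiff (fun x => f (Psi x)) xb y -> 0 < eps ->
  exists x z v a b, [/\ norm (vsub x xb) < eps /\ norm (vsub z (Psi xb)) < eps,
    f z = Some a, f (Psi xb) = Some b,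
    Rabs (a - b) < eps & rsubdiff f z v /\ norm (vsub (J x v) y) < eps].
Proof.
move=> Hy eps0; have [b [fb _]] := Hy.
have e0 : 0 < eps / 4 by lra.
set e := eps / 4 in e0.
(* The slope is [e / 2] here but [e] in [pen]: the surplus makes [xb] a strict local minimiser of
   the limiting problem. *)
have [|del [d0 Hdel]] := rsubdiff_at Hy fb (eps := e / 2); first lra.
have [|d2 [d20 Hd2]] := f_lsc (z := Psi xb) (r := b - eps); first by rewrite fb /=; lra.
(* Closed balls of half the radii are compact and remain where both local estimates hold. *)
pose r1 := Rmin (del / 2) (eps / 2); pose r2 := Rmin (d2 / 2) (eps / 2).
have r10 : 0 < r1 by apply: Rmin_glb_lt; lra.
have r20 : 0 < r2 by apply: Rmin_glb_lt; lra.
have [r1d r1e] : r1 <= del / 2 /\ r1 <= eps / 2 by apply: le_Rmin; apply: Rle_refl.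
have [r2d r2e] : r2 <= d2 / 2 /\ r2 <= eps / 2 by apply: le_Rmin; apply: Rle_refl.
pose K (t : vec p * vec q) := norm (vsub t.1 xb) <= r1 /\ norm (vsub t.2 (Psi xb)) <= r2.
pose pen (j : nat) x z := - inner y (vsub x xb) + e * norm (vsub x xb) +
  (INR j + 1) * inner (vsub (Psi x) z) (vsub (Psi x) z).
have Kcomp (s : nat -> vec p * vec q) : (forall j, K (s j)) -> exists sg x z,
    [/\ K (x, z), forall j, (j <= sg j)%N, vcv (fun j => (s (sg j)).1) x
      & vcv (fun j => (s (sg j)).2) z].
  move=> Ks.
  have [j|sg1 [x [sg1j Hx]]] := @bolzano_weierstrass _ (fun j => (s j).1) (norm xb + r1).
    by case: (Ks j) => + _; have := norm_le_add (s j).1 xb; lra.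
  have [j|sg2 [z [sg2j Hz]]] :=
      @bolzano_weierstrass _ (fun j => (s (sg1 j)).2) (norm (Psi xb) + r2).
    by case: (Ks (sg1 j)) => _; have := norm_le_add (s (sg1 j)).2 (Psi xb); lra.
  have {}Hx := vcv_sub sg2j Hx.
  exists (fun j => sg1 (sg2 j)), x, z; split=> //.
    split=> /=.
      apply: Un_cv_le_eventually (norm_cv (vcv_vsub Hx (vcv_const xb))) _.
      by exists 0%N => j _; case: (Ks (sg1 (sg2 j))).
    apply: Un_cv_le_eventually (norm_cv (vcv_vsub Hz (vcv_const (Psi xb)))) _.
    by exists 0%N => j _; case: (Ks (sg1 (sg2 j))).
  by move=> j; apply: leq_trans (sg2j j) (sg1j _).
have Psi_cv s x : vcv s x -> vcv (fun j => Psi (s j)) (Psi x) := adiff_continuous (@HJ x) (s := s).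
have pen_cv j s t x z : vcv s x -> vcv t z ->
    Un_cv (fun i => pen j (s i) (t i)) (pen j x z).
  move=> sx tz.
  have Hx := vcv_vsub sx (vcv_const xb); have Hz := vcv_vsub (Psi_cv _ _ sx) tz.
  apply: CV_plus; first apply: CV_plus.
  - exact: CV_opp (inner_cv (vcv_const y) Hx).
  - exact: (CV_mult _ _ _ _ (Un_cv_const e) (norm_cv Hx)).
  - exact: (CV_mult _ _ _ _ (Un_cv_const (INR j + 1)) (inner_cv Hz Hz)).
have K0 : K (xb, Psi xb) by rewrite /K /= !norm_subxx; lra.
have pen0 j : pen j xb (Psi xb) = 0.
  by rewrite /pen norm_subxx !inner_subxx; lra.
have /functional_choice [m Hm] : forall j : nat, exists m : vec p * vec q * R,
    [/\ K m.1, f m.1.2 = Some m.2 & forall t, K t ->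
      ege (eadd (f t.2) (pen j t.1 t.2)) (m.2 + pen j m.1.1 m.1.2)].
  move=> j.
  have [s Ks||[x z] [a [Kxz E Hmin]]] :=
    @ext_min _ K (fun t => eadd (f t.2) (pen j t.1 t.2)) (xb, Psi xb) b _ K0.
  - have [sg [x [z [Kxz sgj Hx Hz]]]] := Kcomp s Ks.
    exists sg, (x, z); split=> // r /=.
    exact: (lsc_seq_eadd f_lsc Hz (pen_cv j _ _ _ _ Hx Hz)).
  - by rewrite /= fb /= pen0 Rplus_0_r.
  - move: E => /=; case E: (f z) => [a'|] //= [Ea].
    by exists ((x, z), a'); rewrite /= Ea.
pose xs j := (m j).1.1; pose zs j := (m j).1.2; pose av j := (m j).2.
(* Comparison with [(xb, Psi xb)], where the penalty vanishes. *)
have Hle j : av j + pen j (xs j) (zs j) <= b.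
  by case: (Hm j) => _ _ /(_ _ K0); rewrite /= fb /= pen0 Rplus_0_r.
have Hav j : b - eps < av j.
  case: (Hm j) => -[_ /= n2] fz _.
  have := Hd2 (zs j); rewrite fz /=; apply; rewrite /zs; lra.
have [|sg [x [z [[/= Kx Kz] sgj Hx Hz]]]] := Kcomp (fun j => (m j).1).
  by move=> j; case: (Hm j).
have Hxs : vcv (fun j => xs (sg j)) x by [].
have Hzs : vcv (fun j => zs (sg j)) z by [].
pose gap j := vsub (Psi (xs j)) (zs j).
have gap_cv : vcv (fun j => gap (sg j)) (vsub (Psi x) z) := vcv_vsub (Psi_cv _ _ Hxs) Hzs.
(* [Hle] and [Hav] bound [(INR j + 1) * |gap j|^2] by this constant. *)
pose C := eps + norm y * r1.
have gap_le j : inner (gap j) (gap j) <= C * inv_succ j.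
  have := Hle j; have := Hav j; rewrite /pen -/(gap j).
  case: (Hm j) => -[/= n1 _] _ _; rewrite -/(xs j) in n1.
  have := cauchy_schwarz y (vsub (xs j) xb); have := norm_ge0 y => ny.
  have : norm y * norm (vsub (xs j) xb) <= norm y * r1 by apply: Rmult_le_compat_l.
  have : 0 <= e * norm (vsub (xs j) xb) by apply: Rmult_le_pos; [lra | exact: norm_ge0].
  have j0 : 0 < INR j + 1 by have := pos_INR j; lra.
  move=> *; apply: (Rmult_le_reg_l (INR j + 1)) => //.
  have -> : (INR j + 1) * (C * inv_succ j) = C by rewrite /inv_succ; field; lra.
  rewrite /C; lra.
have zE : z = Psi x.
  apply: esym; apply: norm_sub_eq0.
  have L : inner (vsub (Psi x) z) (vsub (Psi x) z) <= 0.
    have CV := CV_mult _ _ _ _ (Un_cv_const C) (Un_cv_sub sgj inv_succ_cv).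
    have := CV_minus _ _ _ _ (inner_cv gap_cv gap_cv) CV.
    rewrite Rmult_0_r Rminus_0_r => /Un_cv_le_eventually; apply.
    by exists 0%N => j _; have := gap_le (sg j); lra.
  by have := norm_sq (vsub (Psi x) z); have := norm_ge0 (vsub (Psi x) z); nra.
have lin_cv : Un_cv (fun j => b + inner y (vsub (xs (sg j)) xb) -
    e * norm (vsub (xs (sg j)) xb)) (b + inner y (vsub x xb) - e * norm (vsub x xb)).
  have Hx' := vcv_vsub Hxs (vcv_const xb).
  apply: CV_minus; last exact: (CV_mult _ _ _ _ (Un_cv_const e) (norm_cv Hx')).
  exact: (CV_plus _ _ _ _ (Un_cv_const b) (inner_cv (vcv_const y) Hx')).
have av_le j : av j <= b + inner y (vsub (xs j) xb) - e * norm (vsub (xs j) xb).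
  have := Hle j; rewrite /pen -/(gap j).
  have : 0 <= (INR j + 1) * inner (gap j) (gap j).
    by apply: Rmult_le_pos; [have := pos_INR j; lra | exact: inner_ge0].
  lra.
(* If [x] differed from [xb], the subgradient inequality at [Psi x = z] and lower semicontinuity
   would put the values [av] above a slope of [- 3/4 e], while minimality keeps them below the slope
   [- e]; any factor strictly between 1/2 and 1 would do. *)
have xE : x = xb.
  apply: norm_sub_eq0; apply: NNPP => nx.
  have {}nx : 0 < norm (vsub x xb) by have := norm_ge0 (vsub x xb); lra.
  have := Hdel x; rewrite -zE => Hx1; have {Hx1} := Hx1 ltac:(lra) => Hx1.
  have : egt (f z) (b + inner y (vsub x xb) - 3 / 4 * e * norm (vsub x xb)).
    have : 0 < e * norm (vsub x xb) by apply: Rmult_lt_0_compat.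
    by case: (f z) Hx1 => //= ?; lra.
  move=> /(lsc_seq f_lsc Hzs) [N HN].
  have : b + inner y (vsub x xb) - 3 / 4 * e * norm (vsub x xb) <=
         b + inner y (vsub x xb) - e * norm (vsub x xb).
    apply: Un_cv_ge_eventually lin_cv _; exists N => j /HN.
    case: (Hm (sg j)) => _ + _; rewrite -/(zs _) => -> /=.
    by have := av_le (sg j); rewrite /av; lra.
  have : 0 < e * norm (vsub x xb) by apply: Rmult_lt_0_compat.
  lra.
subst z x.
(* Far along the sequence the minimiser is interior to both balls, so Fermat's rule applies without
   constraints. *)
have [N1 HN1] := Hxs r1 r10; have [N2 HN2] := Hzs r2 r20.
have /Un_cvP /(_ eps eps0) [N3 HN3] := lin_cv.
pose j := sg (maxn N1 (maxn N2 N3)).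
have n1 : norm (vsub (xs j) xb) < r1 by apply: HN1; apply: leq_maxl.
have n2 : norm (vsub (zs j) (Psi xb)) < r2.
  by apply: HN2; apply: leq_trans (leq_maxr _ _); apply: leq_maxl.
have n3 : av j < b + eps.
  have := HN3 (maxn N1 (maxn N2 N3)) ltac:(by rewrite !leq_max leqnn !orbT).
  move/Rabs_def2; rewrite norm_subxx inner_subxx.
  have := av_le j; rewrite /j; lra.
have [_ fz Hmin] := Hm j; rewrite -/(xs j) -/(zs j) -/(av j) in fz Hmin.
pose M := INR j + 1; have M0 : 0 < M by rewrite /M; have := pos_INR j; lra.
pose v := vsub vzero (vscale (2 * M) (vsub (zs j) (Psi (xs j)))).
have vE w : inner v w = 2 * M * inner (gap j) w.
  rewrite /v /gap innerBl innerZl !innerBl inner0l; lra.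
exists (xs j), (zs j), v, (av j), b; split=> //.
- by split; lra.
- by apply: Rabs_def1; have := Hav j; lra.
split.
  apply: (rsubdiff_quadratic_min (r := r2 - norm (vsub (zs j) (Psi xb))) fz); [lra | lra |].
  move=> z' nz'; rewrite inner0l.
  have := Hmin (xs j, z'); rewrite /K /= => H; have {H} := H _.
  have := norm_sub_triangle (zs j) z' (Psi xb) => tr H.
  have := H ltac:(split; lra); case: (f z') => //= a'; rewrite /pen -/M.
  rewrite -!norm_sq (norm_subC (Psi _) z') (norm_subC (Psi _) (zs j)); lra.
(* One [e] comes from the term [e |x - xb|] of [pen]; the other is split between the linearisation
   error of [Psi] and the quadratic remainder [M |Psi x' - Psi x|^2], which [r5] makes small. *)
apply: Rle_lt_trans (_ : norm _ <= 2 * e) _; last by rewrite /e; lra.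
have [C1 [c1 [C10 c10 calm]]] := adiff_calm (@HJ (xs j)).
have [|d4 [d40 Hd4]] := @HJ (xs j) v (e / 2); first lra.
have MC : 0 <= M * (C1 * C1) by apply: Rmult_le_pos; nra.
pose r5 := e / 2 / (M * (C1 * C1) + 1).
have r50 : 0 < r5 by apply: Rdiv_lt_0_compat; lra.
apply: (@norm_le_of_variation _ _ _
  (Rmin (r1 - norm (vsub (xs j) xb)) (Rmin c1 (Rmin d4 r5)))); first lra.
  by do !apply: Rmin_glb_lt => //; lra.
move=> u /lt_Rmin [u1 /lt_Rmin [u2 /lt_Rmin [u3 u4]]].
pose x' := vadd (xs j) u.
have ux : vsub x' (xs j) = u by apply: vec_ext => i; rewrite /x' /vsub /vadd; lra.
have := Hmin (x', zs j); rewrite /K /= fz /= /pen -/M.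
have := norm_sub_triangle (xs j) x' xb; rewrite ux => tr H.
have {H} := H ltac:(split; lra).
have := calm x'; have := Hd4 x'; rewrite ux => /(_ u3) D /(_ u2) Cm.
have yE : inner y (vsub x' xb) = inner y (vsub (xs j) xb) + inner y u.
  by rewrite -innerDr; congr inner; apply: vec_ext => i; rewrite /x' /vsub /vadd; lra.
have P2 : M * inner (vsub (Psi x') (Psi (xs j))) (vsub (Psi x') (Psi (xs j))) <= e / 2 * norm u.
  apply: Rle_trans (_ : M * (C1 * C1) * (norm u * norm u) <= _); last first.
    by apply: small_square_le => //; [lra | exact: norm_ge0].
  rewrite Rmult_assoc; apply: Rmult_le_compat_l; first lra.
  rewrite -norm_sq (_ : C1 * C1 * _ = (C1 * norm u) * (C1 * norm u)); last ring.
  by apply: Rmult_le_compat => //; apply: norm_ge0.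
(* The cross term of the expanded penalty is [v] paired with the increment of [Psi], which [D]
   compares with [J (xs j) v]. *)
rewrite (inner_sub_expand (Psi (xs j)) (Psi x') (zs j)) yE.
have := Rle_abs (inner v (Psi x') - inner v (Psi (xs j)) - inner (J (xs j) v) u).
move: D P2; rewrite -innerBr vE -/(gap j) (innerBl (J _ _) y) => D P2 Dabs H.
have N0 := Rmult_le_compat_l e _ _ (Rlt_le _ _ e0) tr.
lra.
Qed.

End FuzzyChainRule.

(** * The limiting chain rule and normals to preimages *)

Section LimitingChainRule.
Variables p q : nat.
Variables (Psi : vec p -> vec q) (J : vec p -> vec q -> vec p).
Hypothesis HJ : forall x, adiff Psi x (J x).
Hypothesis J_cont : forall xs x vs v, vcv xs x -> vcv vs v ->
  vcv (fun j => J (xs j) (vs j)) (J x v).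
Hypothesis J_hom : forall x t v, J x (vscale t v) = vscale t (J x v).

(** The fuzzy rule is applied at the [j]-th approximating point with tolerance [inv_succ j]. If the
    subgradients [v' j] blow up, their normalised limit is a unit singular subgradient; [J xb] kills
    it, because the convergent vectors [J (x' j) (v' j)] get multiplied by scalars tending to 0. The
    qualification condition excludes this. *)
Lemma limiting_chain_rule (f : vec q -> option R) xb y : lsc_fun f ->
  (forall v, ssubdiff f (Psi xb) v -> J xb v = vzero -> v = vzero) ->
  subdiff (fun x => f (Psi x)) xb y -> exists v, subdiff f (Psi xb) v /\ J xb v = y.
Proof.
move=> f_lsc QC [b [fb [xs [ys [Hxs [Hf [Hr Hys]]]]]]].
have /functional_choice [m Hm] : forall j : nat, exists m : vec p * vec q * vec q,
    let: (x, z, v) := m in exists a b', [/\ norm (vsub x (xs j)) < inv_succ j /\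
     norm (vsub z (Psi (xs j))) < inv_succ j, f z = Some a, f (Psi (xs j)) = Some b',
     Rabs (a - b') < inv_succ j & rsubdiff f z v /\ norm (vsub (J x v) (ys j)) < inv_succ j].
  move=> j; have [x [z [v [a [b' H]]]]] := fuzzy_chain_rule f_lsc HJ (Hr j) (inv_succ_gt0 j).
  by exists (x, z, v), a, b'.
pose x' j := (m j).1.1; pose z' j := (m j).1.2; pose v' j := (m j).2.
have {}Hm j : exists a b', [/\ norm (vsub (x' j) (xs j)) < inv_succ j /\
     norm (vsub (z' j) (Psi (xs j))) < inv_succ j, f (z' j) = Some a, f (Psi (xs j)) = Some b',
     Rabs (a - b') < inv_succ j &
     rsubdiff f (z' j) (v' j) /\ norm (vsub (J (x' j) (v' j)) (ys j)) < inv_succ j].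
  by move: (Hm j); rewrite /x' /z' /v'; case: (m j) => -[].
have sq (u : nat -> R) : (forall j, 0 <= u j < inv_succ j) -> Un_cv u 0.
  move=> H; apply: Un_cv_squeeze inv_succ_cv => j.
  by rewrite Rminus_0_r Rabs_pos_eq; have := H j; lra.
have Hx' : vcv x' xb.
  apply: (vcv_near Hxs); apply: sq => j; split; first exact: norm_ge0.
  by have [a [b' [[]]]] := Hm j.
have Hz' : vcv z' (Psi xb).
  apply: (vcv_near (adiff_continuous (@HJ xb) Hxs)); apply: sq => j.
  by split; [exact: norm_ge0 | have [a [b' [[]]]] := Hm j].
have HJv : vcv (fun j => J (x' j) (v' j)) y.
  apply: (vcv_near Hys); apply: sq => j; split; first exact: norm_ge0.
  by have [a [b' [_ _ _ _ []]]] := Hm j.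
have Hfz : ecv (fun j => f (z' j)) b.
  move=> eps e0; have [|N HN] := Hf (eps / 2); first lra.
  have /Un_cvP /(_ (eps / 2)) [|N' HN'] := inv_succ_cv; first lra.
  exists (maxn N N') => j; rewrite geq_max => /andP [/HN [r [E1 Er]] /HN' /Rabs_def2 E3].
  have [a [b' [_ -> E2 E4 _]]] := Hm j; exists a; split=> //.
  move: E2 E1 => -> [E2]; rewrite E2 in E4.
  have := Rabs_triang (a - r) (r - b); rewrite (_ : a - r + (r - b) = a - b); last lra.
  lra.
have Hv' j : rsubdiff f (z' j) (v' j) by have [a [b' [_ _ _ _ []]]] := Hm j.
have ecv_sub sg : (forall j, (j <= sg j)%N) -> ecv (fun j => f (z' (sg j))) b.
  by move=> sgj eps /Hfz [N HN]; exists N => j Nj; apply: HN; apply: leq_trans (sgj j).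
case: (bounded_or_blowup v') => [[sg [v [sgj Hv]]]|[sg [v [lam [sgj lam0 Hlam Hv v1]]]]].
  exists v; split; last first.
    exact: vcv_unique (J_cont (vcv_sub sgj Hx') Hv) (vcv_sub sgj HJv).
  exists b; split=> //; exists (fun j => z' (sg j)), (fun j => v' (sg j)).
  by split; [exact: vcv_sub | split; [exact: ecv_sub | split]].
have v0 : v = vzero.
  apply: QC.
    exists b; split=> //; exists (fun j => z' (sg j)), (fun j => v' (sg j)), lam.
    split=> //; split=> //; split; first exact: vcv_sub.
    by split; [exact: ecv_sub | split].
  apply: vcv_unique (J_cont (vcv_sub sgj Hx') Hv) _.
  have -> : vzero = vscale 0 y by apply: vec_ext => i; rewrite /vscale /vzero; lra.
  apply: eq_vcv (vcv_scale Hlam (vcv_sub sgj HJv)) => j; by rewrite J_hom.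
by move: v1; rewrite v0 norm_vzero; lra.
Qed.

(** * Normal cones through indicator functions *)

Definition seq_closed k (G : vec k -> Prop) : Prop :=
  forall s l, (forall j, G (s j)) -> vcv s l -> G l.

Definition indic k (G : vec k -> Prop) (z : vec k) : option R :=
  if excluded_middle_informative (G z) then Some 0 else None.

Lemma indic_in k (G : vec k -> Prop) z : G z -> indic G z = Some 0.
Proof. by rewrite /indic; case: excluded_middle_informative. Qed.

Lemma indic_Some k (G : vec k -> Prop) z a : indic G z = Some a -> G z /\ a = 0.
Proof. by rewrite /indic; case: excluded_middle_informative => // Gz [<-]. Qed.

Lemma indic_lsc k (G : vec k -> Prop) : seq_closed G -> lsc_fun (indic G).
Proof.
move=> Gc z r.
case: (classic (G z)) => Gz.
  rewrite indic_in //= => r0; exists 1; split=> [|z' _]; first lra.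
  by rewrite /indic; case: excluded_middle_informative.
move=> _; apply: NNPP => H; apply: Gz.
have /functional_choice [s Hs] : forall j : nat, exists z', norm (vsub z' z) < inv_succ j /\ G z'.
  move=> j; apply: NNPP => H'; apply: H; exists (inv_succ j); split; first exact: inv_succ_gt0.
  move=> z' n; rewrite /indic; case: excluded_middle_informative => // Gz'.
  by case: H'; exists z'.
apply: (Gc s) => [j|]; first by case: (Hs j).
apply/vcv_norm; apply: Un_cv_squeeze inv_succ_cv => j.
by rewrite Rminus_0_r Rabs_pos_eq; [case: (Hs j); lra | exact: norm_ge0].
Qed.

Lemma rsubdiff_indic k (G : vec k -> Prop) z v : rsubdiff (indic G) z v <-> rnormal G z v.
Proof.
split=> [[a [/indic_Some [Gz ->] H]]|[Gz H]].
  split=> // eps /H [del [d0 Hd]]; exists del; split=> // x Gx /Hd.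
  by rewrite indic_in //=; lra.
exists 0; split; first exact: indic_in.
move=> eps /H [del [d0 Hd]]; exists del; split=> // x n.
rewrite /indic; case: excluded_middle_informative => //= Gx.
by have := Hd x Gx n; lra.
Qed.

Lemma rnormal_scale k (G : vec k -> Prop) z v t : 0 < t -> rnormal G z v ->
  rnormal G z (vscale t v).
Proof.
move=> t0 [Gz H]; split=> // eps e0.
have [|del [d0 Hd]] := H (eps / t); first exact: Rdiv_lt_0_compat.
exists del; split=> // x Gx n; rewrite innerZl.
have -> : eps * norm (vsub x z) = t * (eps / t * norm (vsub x z)) by field; lra.
by apply: Rmult_le_compat_l; [lra | exact: Hd].
Qed.

Lemma subdiff_indic k (G : vec k -> Prop) z v : subdiff (indic G) z v <-> lnormal G z v.
Proof.
split=> [[a [/indic_Some [Gz ->] [xs [vs [Hx [_ [Hr Hv]]]]]]]|[Gz [xs [vs [Gx [Hx [Hr Hv]]]]]]].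
  split=> //; exists xs, vs; split; last by split=> //; split=> // j; apply/rsubdiff_indic.
  by move=> j; have [a' [/indic_Some []]] := Hr j.
exists 0; split; first exact: indic_in.
exists xs, vs; split=> //; split; last by split=> // j; apply/rsubdiff_indic.
move=> eps e0; exists 0%N => j _; exists 0; split; first exact: indic_in.
by rewrite Rminus_0_r Rabs_R0.
Qed.

(** Regular normals form a cone, which absorbs the scalars [lam j]. *)
Lemma ssubdiff_indic k (G : vec k -> Prop) z v : ssubdiff (indic G) z v -> lnormal G z v.
Proof.
move=> [a [/indic_Some [Gz ->] [xs [vs [lam [lam0 [_ [Hx [_ [Hr Hv]]]]]]]]]].
have {}Hr j : rnormal G (xs j) (vs j) by apply/rsubdiff_indic.
split=> //; exists xs, (fun j => vscale (lam j) (vs j)); split=> [j|].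
  by case: (Hr j).
by split=> //; split=> // j; apply: rnormal_scale.
Qed.

(** The composition of [indic G] with [Psi] is by definition the indicator of the preimage, so the
    chain rule for functions applies as it stands. *)
Lemma lnormal_preimage (G : vec q -> Prop) xb y : seq_closed G ->
  (forall v, lnormal G (Psi xb) v -> J xb v = vzero -> v = vzero) ->
  lnormal (fun x => G (Psi x)) xb y -> exists v, lnormal G (Psi xb) v /\ J xb v = y.
Proof.
move=> /indic_lsc Gc QC /subdiff_indic Hy.
have [v /ssubdiff_indic|v [/subdiff_indic Hv E]] := limiting_chain_rule Gc _ Hy.
  exact: QC.
by exists v.
Qed.

End LimitingChainRule.

(** * Subgradients of convex functions *)

Lemma rsubdiff_subdiff k (psi : vec k -> option R) x v : rsubdiff psi x v -> subdiff psi x v.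
Proof.
move=> H; have [a [E _]] := H; exists a; split=> //.
exists (fun _ => x), (fun _ => v); split; first exact: vcv_const.
split; last by split; [| exact: vcv_const].
by move=> eps e0; exists 0%N => j _; exists a; rewrite E Rminus_diag Rabs_R0.
Qed.

Section ConvexFunctions.
Variable m : nat.
Variable theta : vec m -> option R.

(** The subgradient of convex analysis. Its inequality is global, hence easy to pass to the
    limit. *)
Definition csub (z v : vec m) : Prop :=
  exists a, theta z = Some a /\ forall z', ege (theta z') (a + inner v (vsub z' z)).

(** For [z] in the domain of [theta], the convex normal cone to that domain at [z]. *)
Definition dom_normal (z v : vec m) : Prop :=
  forall z' b, theta z' = Some b -> inner v (vsub z' z) <= 0.

Lemma csub_rsubdiff z v : csub z v -> rsubdiff theta z v.
Proof.
move=> [a [E H]]; exists a; split=> // eps e0; exists 1; split=> [|x n]; first lra.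
by apply: ege_trans (H x); nra.
Qed.

Lemma csub_subdiff z v : csub z v -> subdiff theta z v.
Proof. by move=> /csub_rsubdiff /rsubdiff_subdiff. Qed.

Hypothesis theta_proper : proper_fun theta.
Hypothesis theta_lsc : lsc_fun theta.
Hypothesis theta_convex : convex_fun theta.

(** A failure by [D] of the global inequality at [z'] is passed on by convexity to the segment
    towards [z], where it is at least [t * D] at parameter [t]. The local inequality with slope
    [D / (2 * n)] allows only [t * D / 2]. *)
Lemma rsubdiff_csub z v : rsubdiff theta z v -> csub z v.
Proof.
move=> [a [Ea H]]; exists a; split=> // z'; case Eb: (theta z') => [b|] //=.
apply: Rnot_lt_le => lt.
case: (Rle_lt_or_eq_dec _ _ (norm_ge0 (vsub z' z))) => n0; last first.
  have E := norm_sub_eq0 (esym n0); move: lt Eb; rewrite E inner_subxx Ea => lt [e]; lra.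
set n := norm _ in n0; pose D := a + inner v (vsub z' z) - b.
have D0 : 0 < D by rewrite /D; lra.
have [|del [d0 Hd]] := H (D / (2 * n)); first by apply: Rdiv_lt_0_compat; lra.
pose t := Rmin 1 (del / (2 * n)).
have t0 : 0 < t by apply: Rmin_glb_lt; [lra | apply: Rdiv_lt_0_compat; lra].
have [t1 t2] : t <= 1 /\ t <= del / (2 * n) by apply: le_Rmin; apply: Rle_refl.
have [|c [Ec cle]] := theta_convex (t := t) Eb Ea; first lra.
have zt : vsub (vadd (vscale t z') (vscale (1 - t) z)) z = vscale t (vsub z' z).
  by apply: vec_ext => i; rewrite /vsub /vadd /vscale; lra.
have := Hd (vadd (vscale t z') (vscale (1 - t) z)).
rewrite zt Ec norm_scale innerZr Rabs_pos_eq -/n /=; last lra.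
have tn : t * n <= del / 2.
  have -> : del / 2 = del / (2 * n) * n by field; lra.
  by apply: Rmult_le_compat_r; lra.
have tn0 : 0 < t * n by apply: Rmult_lt_0_compat.
move=> Hc; have {Hc} := Hc ltac:(split; lra).
have -> : D / (2 * n) * (t * n) = t * (D / 2) by field; lra.
by rewrite /D in D0 *; nra.
Qed.

(** Working with a level [r] below [theta z] treats finite and infinite [theta z] alike. *)
Lemma csub_seq_le zs vs z v z' b r : vcv zs z -> vcv vs v -> (forall j, csub (zs j) (vs j)) ->
  theta z' = Some b -> egt (theta z) r -> r + inner v (vsub z' z) <= b.
Proof.
move=> Hz Hv Hc Eb /(lsc_seq theta_lsc Hz) [N HN].
have L := CV_plus _ _ _ _ (Un_cv_const r) (inner_cv Hv (vcv_vsub (vcv_const z') Hz)).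
apply: Un_cv_le_eventually L _; exists N => j /HN.
by have [a [-> /(_ z')]] := Hc j; rewrite Eb /=; lra.
Qed.

Lemma csub_closed zs vs z v : vcv zs z -> vcv vs v -> (forall j, csub (zs j) (vs j)) -> csub z v.
Proof.
move=> Hz Hv Hc; have H := csub_seq_le Hz Hv Hc.
have [z0] := theta_proper; case E0: (theta z0) => [b0|] // _.
case E: (theta z) H => [a|] H.
  exists a; split=> // z'; case Eb: (theta z') => [b|] //=.
  apply: le_epsilon => eps e0.
  by have := H z' b (a - eps) Eb; rewrite /=; lra.
(* If [theta z] were infinite, [r] could be arbitrarily large; this one violates the bound at [z0]
   by 1. *)
by have := H z0 b0 (b0 - inner v (vsub z0 z) + 1) E0 I; lra.
Qed.

Lemma subdiff_csub z v : subdiff theta z v <-> csub z v.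
Proof.
split; last exact: csub_subdiff.
move=> [a [_ [xs [vs [Hx [_ [Hr Hv]]]]]]].
by apply: csub_closed Hx Hv _ => j; apply: rsubdiff_csub.
Qed.

(** Multiplied by [lam j], the subgradient inequality loses its function values in the limit. *)
Lemma ssubdiff_dom_normal z v : ssubdiff theta z v -> dom_normal z v.
Proof.
move=> [a [Ea [xs [vs [lam [lam0 [Hlam [Hx [Hf [Hr Hv]]]]]]]]]] z' b Eb.
have [N HN] := Hf 1 Rlt_0_1.
have L := CV_minus _ _ _ _ (inner_cv Hv (vcv_vsub (vcv_const z') Hx))
  (CV_mult _ _ _ _ Hlam (Un_cv_const (b - a + 1))).
rewrite Rmult_0_l Rminus_0_r in L.
apply: Un_cv_le_eventually L _; exists N => j /HN [r [Er /Rabs_def2 ra]].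
have [a' [Ea' /(_ z')]] := rsubdiff_csub (Hr j).
move: Ea'; rewrite Er Eb /= innerZl => -[<-] Hb.
have := Rmult_le_compat_l (lam j) _ _ (Rlt_le _ _ (lam0 j)) Hb; have := lam0 j; nra.
Qed.

Lemma dom_normal_closed zs vs z v : vcv zs z -> vcv vs v ->
  (forall j, dom_normal (zs j) (vs j)) -> dom_normal z v.
Proof.
move=> Hz Hv Hn z' b Eb.
apply: Un_cv_le_eventually (inner_cv Hv (vcv_vsub (vcv_const z') Hz)) _.
by exists 0%N => j _; apply: (Hn j) Eb.
Qed.

(* [theta (zs j)] need not converge to [theta z], so [v] is not directly a singular
   subgradient in the sense of [ssubdiff]. *)
Lemma blowup_dom_normal zs vs lam z v : vcv zs z -> Un_cv lam 0 -> (forall j, 0 < lam j) ->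
  (forall j, csub (zs j) (vs j)) -> vcv (fun j => vscale (lam j) (vs j)) v ->
  (exists a, theta z = Some a) -> dom_normal z v.
Proof.
move=> Hz Hlam lam0 Hc Hv [a Ea] z' b Eb.
have [|N HN] := lsc_seq (r := a - 1) theta_lsc Hz; first by rewrite Ea /=; lra.
have L := CV_minus _ _ _ _ (inner_cv Hv (vcv_vsub (vcv_const z') Hz))
  (CV_mult _ _ _ _ Hlam (Un_cv_const (b - a + 1))).
rewrite Rmult_0_l Rminus_0_r in L.
apply: Un_cv_le_eventually L _; exists N => j /HN.
have [a' [-> /(_ z')]] := Hc j; rewrite Eb /= innerZl => Hb ra.
have := Rmult_le_compat_l (lam j) _ _ (Rlt_le _ _ (lam0 j)) Hb; have := lam0 j; nra.
Qed.

(* Minimise [theta - M^2 <v, . - z> + M |. - z|^2] near [z]: since [v] is normal to the domain,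
   the minimiser is O(M^(-1/2))-close to [z], and Fermat's rule there yields a subgradient
   which, divided by [M^2], is close to [v]. *)
Lemma dom_normal_approx z v a eps : dom_normal z v -> theta z = Some a -> 0 < eps ->
  exists z' w lam b, [/\ norm (vsub z' z) < eps, theta z' = Some b, Rabs (b - a) < eps,
    rsubdiff theta z' w & 0 < lam < eps /\ norm (vsub (vscale lam w) v) < eps].
Proof.
move=> Hn Ea e0.
have Kcomp (s : nat -> vec m) : (forall j, norm (vsub (s j) z) <= 1) -> exists sg l,
    [/\ norm (vsub l z) <= 1, forall j, (j <= sg j)%N & vcv (fun j => s (sg j)) l].
  move=> Ks; have [j|sg [l [sgj Hl]]] := @bolzano_weierstrass _ s (norm z + 1).
    by have := norm_le_add (s j) z; have := Ks j; lra.
  exists sg, l; split=> //.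
  by apply: Un_cv_le_eventually (norm_cv (vcv_vsub Hl (vcv_const z))) _; exists 0%N.
have z1 : norm (vsub z z) <= 1 by rewrite norm_subxx; lra.
have min (u : vec m -> R) : (forall s l, vcv s l -> Un_cv (fun j => u (s j)) (u l)) ->
    exists t b, [/\ norm (vsub t z) <= 1, theta t = Some b &
      forall t', norm (vsub t' z) <= 1 -> ege (eadd (theta t') (u t')) (b + u t)].
  move=> uc.
  have [s Ks||t [b [Kt E Hmin]]] :=
    @ext_min _ (fun t => norm (vsub t z) <= 1) (fun t => eadd (theta t) (u t)) z (a + u z) _ z1.
  - have [sg [l [Kl sgj Hl]]] := Kcomp s Ks; exists sg, l; split=> // r.
    exact: (lsc_seq_eadd theta_lsc Hl (uc _ _ Hl)).
  - by rewrite /= Ea.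
  - by move: E Hmin; case E: (theta t) => [b'|] //= [<-] H; exists t, b'.
(* Minimising with zero perturbation yields a lower bound [L] of [theta] on the unit ball. *)
have [t0 [L [_ _ HL]]] := min (fun _ => 0) (fun _ _ _ => Un_cv_const 0).
have {}HL z' b : norm (vsub z' z) <= 1 -> theta z' = Some b -> L <= b.
  by move=> /HL + E; rewrite E /=; lra.
have aL := HL _ _ z1 Ea.
have [del [d0 Hd]] : exists del, 0 < del /\ forall z', norm (vsub z' z) < del ->
    egt (theta z') (a - eps) by apply: theta_lsc; rewrite Ea /=; lra.
pose r := Rmin 1 (Rmin del eps).
have r0 : 0 < r by do !apply: Rmin_glb_lt => //; lra.
(* [M * r^2 > a - L] will force the minimiser into the ball of radius [r]; [M * eps > 2] will make
   the final error [2 / M] small. *)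
have [N1 HN1] := INR_unbounded ((a - L) / (r * r)).
have [N2 HN2] := INR_unbounded (2 / eps).
pose M := INR N1 + INR N2 + 1.
have p1 := pos_INR N1; have p2 := pos_INR N2.
have M1 : 1 <= M by rewrite /M; lra.
have rr0 : 0 < r * r by apply: Rmult_lt_0_compat.
have Mr : a - L < M * (r * r).
  have -> : a - L = (a - L) / (r * r) * (r * r) by field; lra.
  by apply: Rmult_lt_compat_r => //; rewrite /M; lra.
have Me : 2 < M * eps.
  have -> : 2 = 2 / eps * eps by field; lra.
  by apply: Rmult_lt_compat_r => //; rewrite /M; lra.
pose u z' := - (M * M * inner v (vsub z' z)) + M * inner (vsub z' z) (vsub z' z).
have [s l Hl|t [b [Kt Eb Hmin]]] := min u.
  have Hl' := vcv_vsub Hl (vcv_const z).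
  apply: CV_plus; last exact: (CV_mult _ _ _ _ (Un_cv_const M) (inner_cv Hl' Hl')).
  apply: CV_opp.
  exact: (CV_mult _ _ _ _ (Un_cv_const (M * M)) (inner_cv (vcv_const v) Hl')).
have vt := Hn t b Eb.
have := Hmin z z1; rewrite Ea /= /u !inner_subxx -norm_sq; set n := norm _ => Hle.
have n0 : 0 <= n := norm_ge0 _.
have MM : 0 <= M * M by nra.
have bn : b + M * (n * n) <= a by nra.
have Lb := HL _ _ Kt Eb.
have nr : n < r.
  by apply: Rnot_le_lt => rn; have : r * r <= n * n by [apply: Rmult_le_compat; lra]; nra.
have /lt_Rmin [n1 /lt_Rmin [n2 n3]] := nr.
pose w := vsub (vscale (M * M) v) (vscale (2 * M) (vsub t z)).
exists t, w, (/ (M * M)), b; split=> //.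
- by apply: Rabs_def1; [nra | have := Hd t n2; rewrite Eb /=; lra].
- apply: (rsubdiff_quadratic_min (r := 1 - n) Eb); [lra | lra |] => z' nz'.
  have := norm_sub_triangle t z' z; rewrite -/n => tr.
  have := Hmin z' ltac:(lra); case: (theta z') => //= b'; rewrite /u.
  rewrite innerZl (_ : inner v (vsub z' t) = inner v (vsub z' z) - inner v (vsub t z)); first lra.
  by rewrite !innerBr; lra.
have iM : 0 < / M by apply: Rinv_0_lt_compat; lra.
have iMe : / M < eps / 2.
  apply: (Rmult_lt_reg_l M); first lra.
  by rewrite Rinv_r; lra.
have iM1 : / M <= 1 by rewrite -Rinv_1; apply: Rinv_le_contravar; lra.
split.
  rewrite Rinv_mult; split; first exact: Rmult_lt_0_compat.
  have : / M * / M <= / M * 1 by apply: Rmult_le_compat_l; lra.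
  lra.
have -> : vsub (vscale (/ (M * M)) w) v = vscale (- (2 * / M)) (vsub t z).
  apply: vec_ext => i; rewrite /w /vsub /vscale.
  by field; lra.
rewrite norm_scale Rabs_Ropp Rabs_pos_eq -/n; last lra.
have : 2 * / M * n <= 2 * / M * 1 by apply: Rmult_le_compat_l; lra.
lra.
Qed.

(** Converse of [ssubdiff_dom_normal] at points of the domain. Through it, limits of domain normals
    fall under a qualification condition stated for singular subgradients. *)
Lemma dom_normal_ssubdiff z v : dom_normal z v -> (exists a, theta z = Some a) ->
  ssubdiff theta z v.
Proof.
move=> Hn [a Ea]; exists a; split=> //.
have /functional_choice [f Hf] : forall j : nat, exists f : vec m * vec m * R,
    let: (z', w, lam) := f in exists b, [/\ norm (vsub z' z) < inv_succ j, theta z' = Some b,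
     Rabs (b - a) < inv_succ j, rsubdiff theta z' w &
     0 < lam < inv_succ j /\ norm (vsub (vscale lam w) v) < inv_succ j].
  move=> j; have [z' [w [lam [b H]]]] := dom_normal_approx Hn Ea (inv_succ_gt0 j).
  by exists (z', w, lam), b.
pose z' j := (f j).1.1; pose w j := (f j).1.2; pose lam j := (f j).2.
have {}Hf j : exists b, [/\ norm (vsub (z' j) z) < inv_succ j, theta (z' j) = Some b,
     Rabs (b - a) < inv_succ j, rsubdiff theta (z' j) (w j) &
     0 < lam j < inv_succ j /\ norm (vsub (vscale (lam j) (w j)) v) < inv_succ j].
  by move: (Hf j); rewrite /z' /w /lam; case: (f j) => -[].
have sq (u : nat -> R) : (forall j, 0 <= u j < inv_succ j) -> Un_cv u 0.
  move=> H; apply: Un_cv_squeeze inv_succ_cv => j.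
  by rewrite Rminus_0_r Rabs_pos_eq; have := H j; lra.
exists z', w, lam; split; first by move=> j; have [b [_ _ _ _ [[]]]] := Hf j.
split; first by apply: sq => j; have [b [_ _ _ _ [[]]]] := Hf j; lra.
split.
  by apply/vcv_norm; apply: sq => j; split; [exact: norm_ge0 | have [b []] := Hf j].
split.
  move=> eps e0; have /Un_cvP /(_ eps e0) [N HN] := inv_succ_cv.
  exists N => j /HN /Rabs_def2 H; have [b [_ E1 E2 _ _]] := Hf j; exists b; split=> //; lra.
split; first by move=> j; have [b []] := Hf j.
by apply/vcv_norm; apply: sq => j; split; [exact: norm_ge0 | have [b [_ _ _ _ []]] := Hf j].
Qed.

End ConvexFunctions.

(** * Coderivatives of parametrized subgradient mappings *)

Lemma rsubdiff_local k (psi psi' : vec k -> option R) x v r : 0 < r ->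
  (forall x', norm (vsub x' x) < r -> psi x' = psi' x') ->
  rsubdiff psi x v -> rsubdiff psi' x v.
Proof.
move=> r0 H [a [E Hv]]; exists a; split; first by rewrite -H // norm_subxx.
move=> eps /Hv [del [d0 Hd]]; exists (Rmin del r); split; first exact: Rmin_glb_lt.
by move=> x' [n0 /lt_Rmin [n1 n2]]; rewrite -H //; apply: Hd.
Qed.

Lemma subdiff_local k (psi psi' : vec k -> option R) x v r : 0 < r ->
  (forall x', norm (vsub x' x) < r -> psi x' = psi' x') ->
  subdiff psi x v -> subdiff psi' x v.
Proof.
move=> r0 H [a [E [xs [vs [Hx [Hf [Hr Hv]]]]]]].
exists a; split; first by rewrite -H // norm_subxx.
have [N HN] := Hx r r0.
(* Skips the terms outside the ball while keeping [j <= sg j]. *)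
pose sg j := maxn N j.
have sgj j : (j <= sg j)%N := leq_maxr N j.
have near j : norm (vsub (xs (sg j)) x) < r := HN _ (leq_maxl N j).
exists (fun j => xs (sg j)), (fun j => vs (sg j)).
split; first exact: (vcv_sub sgj Hx).
split.
  move=> eps /Hf [M HM]; exists M => j Mj; rewrite -H //.
  by apply: HM; apply: leq_trans (sgj j).
split; last exact: (vcv_sub sgj Hv).
move=> j; apply: (rsubdiff_local (r := r - norm (vsub (xs (sg j)) x))) (Hr (sg j)).
  by have := near j; lra.
by move=> x' n; apply: H; have := norm_sub_triangle (xs (sg j)) x' x; lra.
Qed.

(** The easy inclusion of the chain rule: an affine minorant of [theta], composed with [Psi], is a
    minorant of the composition that is linear up to first order. *)
Lemma csub_comp_rsubdiff p q (theta : vec q -> option R) (Psi : vec p -> vec q) x J v :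
  adiff Psi x J -> csub theta (Psi x) v -> rsubdiff (fun x' => theta (Psi x')) x (J v).
Proof.
move=> HJ [a [E H]]; exists a; split=> // eps /(HJ v) [del [d0 Hd]].
exists del; split=> // x' [_ /Hd].
have := H (Psi x'); rewrite innerBr => H1.
have := Rle_abs (- (inner v (Psi x') - inner v (Psi x) - inner (J v) (vsub x' x))).
rewrite Rabs_Ropp => H2 H3; apply: ege_trans H1; lra.
Qed.

(** [Phi] maps [Om'] near [x] into [Om], and calmness turns an error small against
    [|Phi x' - Phi x|] into one small against [|x' - x|]. *)
Lemma rnormal_pullback p q (Om : vec q -> Prop) (Om' : vec p -> Prop) (Phi : vec p -> vec q)
    x J v r : adiff Phi x J -> Om' x -> 0 < r ->
  (forall x', norm (vsub x' x) < r -> Om' x' -> Om (Phi x')) ->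
  rnormal Om (Phi x) v -> rnormal Om' x (J v).
Proof.
move=> HJ Ox r0 HO [_ Hv]; split=> // eps e0.
have [C [c [C0 c0 calm]]] := adiff_calm HJ.
have [|d1 [d10 H1]] := Hv (eps / 2 / C); first by apply: Rdiv_lt_0_compat; lra.
have [|d2 [d20 H2]] := HJ v (eps / 2); first lra.
exists (Rmin (Rmin r c) (Rmin d2 (d1 / C))); split.
  by do !apply: Rmin_glb_lt => //; apply: Rdiv_lt_0_compat.
move=> x' Ox' [n0 /lt_Rmin [/lt_Rmin [nr /calm cx] /lt_Rmin [/H2 {}H2 n3]]].
set n := norm (vsub x' x) in n0 nr cx H2 n3 *.
have main : inner v (vsub (Phi x') (Phi x)) <= eps / 2 * n.
  (* [Phi x'] may equal [Phi x], a point that [rnormal] leaves out; the left side is then 0. *)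
  case: (Rle_lt_or_eq_dec _ _ (norm_ge0 (vsub (Phi x') (Phi x)))) => m0; last first.
    by rewrite (norm_sub_eq0 (esym m0)) inner_subxx; nra.
  have Cn : C * n < d1.
    have -> : d1 = C * (d1 / C) by field; lra.
    exact: Rmult_lt_compat_l.
  apply: Rle_trans (H1 _ (HO _ nr Ox') _) _; first by split=> //; lra.
  have -> : eps / 2 * n = eps / 2 / C * (C * n) by field; lra.
  apply: Rmult_le_compat_l cx.
  by apply: Rlt_le; apply: Rdiv_lt_0_compat; lra.
have := Rle_abs (- (inner v (Phi x') - inner v (Phi x) - inner (J v) (vsub x' x))).
by rewrite Rabs_Ropp; rewrite innerBr in main; lra.
Qed.

Lemma fdiff_inner N (g z : vec N) : fdiff (fun z' => inner g z') z g.
Proof.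
move=> eps e0; exists 1; split=> [|z' _]; first lra.
rewrite innerBr Rminus_diag Rabs_R0; have := norm_ge0 (vsub z' z); nra.
Qed.

Lemma fdiff_vr p q (F : vec q -> R) (z : vec (p + q)%N) g :
  fdiff F (vr z) g -> fdiff (fun z' : vec (p + q)%N => F (vr z')) z (vcat vzero g).
Proof.
move=> H eps e0; have [del [d0 Hd]] := H eps e0; exists del; split=> // z' n.
have n' : norm (vsub (vr z') (vr z)) <= norm (vsub z' z) := norm_vr (vsub z' z).
have := Hd (vr z'); rewrite inner_split vl_vcat vr_vcat inner0l Rplus_0_l => Hz.
apply: Rle_trans (Hz _) _; first lra.
by apply: Rmult_le_compat_l; lra.
Qed.

Lemma fdiff_cv N (F : vec N -> R) z g s : fdiff F z g -> vcv s z -> Un_cv (fun j => F (s j)) (F z).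
Proof.
move=> /fdiff_calm [C [del [C0 d0 H]]] sz; apply/Un_cvP => eps e0.
have [|M HM] := sz (Rmin del (eps / C)).
  by apply: Rmin_glb_lt => //; apply: Rdiv_lt_0_compat.
exists M => j /HM /lt_Rmin [/H {}H n]; apply: Rle_lt_trans H _.
have -> : eps = C * (eps / C) by field; lra.
exact: Rmult_lt_compat_l.
Qed.

Lemma ebasisC k (i j : 'I_k) : ebasis i j = ebasis j i.
Proof. by rewrite /ebasis eq_sym. Qed.

(** * One coderivative estimate for both inclusions *)

Section ParametrizedSubgradients.
Variables N n m : nat.
Variables (theta : vec m -> option R) (H : vec N -> vec m) (DH : 'I_m -> vec N -> vec N).
Variables (a : 'I_m -> 'I_n -> vec N -> R) (Da : 'I_m -> 'I_n -> vec N -> vec N).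
Hypothesis theta_proper : proper_fun theta.
Hypothesis theta_lsc : lsc_fun theta.
Hypothesis theta_convex : convex_fun theta.
Hypothesis H_diff : forall l s, fdiff (fun s' => H s' l) s (DH l s).
Hypothesis a_diff : forall l i s, fdiff (a l i) s (Da l i s).
Hypothesis DH_cv : forall l ss s, vcv ss s -> vcv (fun j => DH l (ss j)) (DH l s).
Hypothesis Da_cv : forall l i ss s, vcv ss s -> vcv (fun j => Da l i (ss j)) (Da l i s).

(** [A] abstracts [jacx_t]. [DHt] is the transposed derivative of [H] in all of [s]: it agrees with
    [A] when [s = x], and consists of the blocks [jacx_t] and [jacw_t] when [s = (x, w)]. *)
Let A (s : vec N) (v : vec m) : vec n := fun i => vsum (fun l => v l * a l i s).
Let DHt (s : vec N) (v : vec m) : vec N := fun j => vsum (fun l => v l * DH l s j).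

Let Psi (x : vec (N + m)%N) : vec (m + m)%N := vcat (H (vl x)) (vr x).
Let JPsi (x : vec (N + m)%N) (v : vec (m + m)%N) : vec (N + m)%N :=
  vcat (DHt (vl x) (vl v)) (vr v).

Let Phi (x : vec (N + m)%N) : vec (N + n)%N := vcat (vl x) (A (vl x) (vr x)).
(** Evaluated at [(p, - u)], the first block is [p] minus the Hessian term and the second is minus
    the partial Jacobian applied to [u]. *)
Let JPhi (x : vec (N + m)%N) (v : vec (N + n)%N) : vec (N + m)%N :=
  vcat (fun j => vl v j + vsum (fun i => vr v i * vsum (fun l => vr x l * Da l i (vl x) j)))
       (fun l => vsum (fun i => vr v i * a l i (vl x))).

Lemma A_cv ss s vs v : vcv ss s -> vcv vs v -> vcv (fun j => A (ss j) (vs j)) (A s v).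
Proof.
move=> Hs /vcv_coord Hv; apply/vcv_coord => i; apply: vsum_cv => l.
exact: (CV_mult _ _ _ _ (Hv l) (fdiff_cv (@a_diff l i s) Hs)).
Qed.

Lemma A_scale s t v : A s (vscale t v) = vscale t (A s v).
Proof.
by apply: vec_ext => i; rewrite /A /vscale -vsumZ; apply: eq_vsum => l; lra.
Qed.

Lemma Psi_adiff x : adiff Psi x (JPsi x).
Proof.
move=> v; apply: eq_fdiff (fdiff_add
  (fdiff_vsum (fun l => fdiff_scale (vl v l) (fdiff_vl (@H_diff l (vl x)))))
  (fdiff_vr (fdiff_inner (vr v) (vr x)))).
  by move=> x'; rewrite /Psi inner_split vl_vcat vr_vcat.
apply: vec_ext => i; rewrite /JPsi /vadd -(splitK i); case: (split i) => k /=.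
  rewrite !vcat_lshift /vzero Rplus_0_r; apply: eq_vsum => l.
  by rewrite /vscale vcat_lshift.
rewrite !vcat_rshift -[RHS]Rplus_0_l; congr Rplus; rewrite -(vsum_const0 m).
by apply: eq_vsum => l; rewrite /vscale vcat_rshift /vzero; lra.
Qed.

Lemma JPsi_cv xs x vs v : vcv xs x -> vcv vs v -> vcv (fun j => JPsi (xs j) (vs j)) (JPsi x v).
Proof.
move=> Hx Hv; apply: vcv_cat; last exact: vcv_vr.
apply/vcv_coord => i; apply: vsum_cv => l; apply: CV_mult.
  by move/vcv_coord: (vcv_vl Hv); apply.
by move/vcv_coord: (DH_cv l (vcv_vl Hx)); apply.
Qed.

Lemma JPsi_scale x t v : JPsi x (vscale t v) = vscale t (JPsi x v).
Proof.
apply: vec_ext => i; rewrite /JPsi /vscale -(splitK i); case: (split i) => k /=.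
  by rewrite !vcat_lshift /DHt -vsumZ; apply: eq_vsum => l; rewrite /vl; lra.
by rewrite !vcat_rshift.
Qed.

Lemma Phi_adiff x : adiff Phi x (JPhi x).
Proof.
move=> v; apply: eq_fdiff (fdiff_add (fdiff_vl (fdiff_inner (vl v) (vl x)))
  (fdiff_vsum (fun i => fdiff_scale (vr v i) (fdiff_vsum (fun l =>
    fdiff_mul (fdiff_vr (fdiff_coord l (vr x))) (fdiff_vl (@a_diff l i (vl x)))))))).
  by move=> x'; rewrite /Phi inner_split vl_vcat vr_vcat.
apply: vec_ext => j; rewrite /JPhi /vadd -(splitK j); case: (split j) => k /=.
  rewrite !vcat_lshift; congr Rplus; apply: eq_vsum => i; rewrite /vscale; congr Rmult.
  by apply: eq_vsum => l; rewrite !vcat_lshift /vzero; lra.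
rewrite !vcat_rshift /vzero Rplus_0_l; apply: eq_vsum => i; rewrite /vscale; congr Rmult.
rewrite -(vsum_delta (fun l => a l i (vl x)) k); apply: eq_vsum => l.
by rewrite !vcat_rshift /vzero (ebasisC k l); lra.
Qed.

Lemma JPhi_cv xs x vs v : vcv xs x -> vcv vs v -> vcv (fun j => JPhi (xs j) (vs j)) (JPhi x v).
Proof.
move=> Hx Hv; have /vcv_coord Hvr := vcv_vr Hv; have /vcv_coord Hvl := vcv_vl Hv.
have /vcv_coord Hxr := vcv_vr Hx; have Hxl := vcv_vl Hx.
apply: vcv_cat; apply/vcv_coord => j.
  apply: (CV_plus _ _ _ _ (Hvl j)); apply: vsum_cv => i; apply: (CV_mult _ _ _ _ (Hvr i)).
  apply: vsum_cv => l; apply: (CV_mult _ _ _ _ (Hxr l)).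
  by move/vcv_coord: (Da_cv l i Hxl); apply.
apply: vsum_cv => i.
exact: (CV_mult _ _ _ _ (Hvr i) (fdiff_cv (@a_diff j i (vl x)) Hxl)).
Qed.

Variables (F : vec N -> vec n -> Prop) (sb : vec N) (yb : vec n) (r : R).
Hypothesis r0 : 0 < r.
Hypothesis F_rep : forall s, norm (vsub s sb) < r ->
  forall y, F s y <-> exists v, subdiff theta (H s) v /\ A s v = y.
Hypothesis theta_dom : exists b, theta (H sb) = Some b.
Hypothesis QC : forall v, ssubdiff theta (H sb) v -> A sb v = vzero -> v = vzero.
Hypothesis SOQC : forall v, subdiff theta (H sb) v -> A sb v = yb ->
  forall w, sosubdiff theta (H sb) v vzero w -> DHt sb w = vzero -> w = vzero.

Lemma coderiv_parametrized u p : coderiv F sb yb u p ->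
  exists v, subdiff theta (H sb) v /\ A sb v = yb /\
    exists q, sosubdiff theta (H sb) v (fun l => vsum (fun i => a l i sb * u i)) q /\
      p = vadd (fun j => vsum (fun i => vsum (fun l => v l * Da l i sb j) * u i)) (DHt sb q).
Proof.
move=> [_ [zs [ns [Fz [Hz [Hr Hns]]]]]].
have H_cont s x : vcv s x -> vcv (fun j => H (s j)) (H x).
  by move=> sx; apply/vcv_coord => l; apply: fdiff_cv (@H_diff l x) sx.
have Hs0 := vcv_vl Hz; rewrite vl_vcat in Hs0.
have Hy0 := vcv_vr Hz; rewrite vr_vcat in Hy0.
have [N0 HN0] := Hs0 r r0.
pose sg0 j := maxn N0 j.
have sg0j j : (j <= sg0 j)%N := leq_maxr N0 j.
pose s j := vl (zs (sg0 j)); pose y j := vr (zs (sg0 j)).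
have near j : norm (vsub (s j) sb) < r := HN0 _ (leq_maxl N0 j).
have Hs : vcv s sb := vcv_sub sg0j Hs0.
have Hy : vcv y yb := vcv_sub sg0j Hy0.
have /functional_choice [v Hv] : forall j : nat,
    exists v, subdiff theta (H (s j)) v /\ A (s j) v = y j.
  by move=> j; apply/(F_rep (near j)); apply: Fz.
have Hc j : csub theta (H (s j)) (v j) by apply/subdiff_csub => //; case: (Hv j).
(* Boundedness of multipliers: after a blow-up, the normalised limit would be a unit domain normal
   killed by [A sb], against [QC]. *)
have [sg [vb [sgj Hvb]]] : exists sg l, (forall j, (j <= sg j)%N) /\ vcv (fun j => v (sg j)) l.
  case: (bounded_or_blowup v) => // -[sg [l [lam [sgj lam0 Hlam Hl l1]]]].
  have Hs' := vcv_sub sgj Hs.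
  have l0 : l = vzero.
    apply: QC.
      apply: dom_normal_ssubdiff => //.
      exact: (blowup_dom_normal theta_lsc (H_cont _ _ Hs') Hlam lam0 (fun j => Hc (sg j)) Hl).
    apply: vcv_unique (A_cv Hs' Hl) _.
    have -> : vzero = vscale 0 yb by apply: vec_ext => i; rewrite /vscale /vzero; lra.
    apply: eq_vcv (vcv_scale Hlam (vcv_sub sgj Hy)) => j.
    by rewrite A_scale; case: (Hv (sg j)) => _ ->.
  by move: l1; rewrite l0 norm_vzero; lra.
have Hs' := vcv_sub sgj Hs.
have vb_sub : subdiff theta (H sb) vb.
  by apply/subdiff_csub => //; apply: (csub_closed theta_proper theta_lsc (H_cont _ _ Hs') Hvb).
have vb_y : A sb vb = yb.
  apply: vcv_unique (A_cv Hs' Hvb) _.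
  by apply: eq_vcv (vcv_sub sgj Hy) => j; case: (Hv (sg j)).
exists vb; split=> //; split=> //.
pose G (z : vec (m + m)%N) := subdiff theta (vl z) (vr z).
have G_closed : seq_closed G.
  move=> t l Gt tl; apply/subdiff_csub => //.
  apply: (csub_closed theta_proper theta_lsc (vcv_vl tl) (vcv_vr tl)) => j.
  by apply/subdiff_csub => //; apply: Gt.
pose xb := vcat sb vb.
have GPsi x : G (Psi x) <-> subdiff theta (H (vl x)) (vr x) by rewrite /G /Psi vl_vcat vr_vcat.
pose nb := vcat p (vopp u).
have Lpre : lnormal (fun x => G (Psi x)) xb (JPhi xb nb).
  split; first by apply/GPsi; rewrite vl_vcat vr_vcat.
  pose x j := vcat (s (sg j)) (v (sg j)).
  have Gx j : G (Psi (x j)) by apply/GPsi; rewrite vl_vcat vr_vcat; case: (Hv (sg j)).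
  have Hx : vcv x xb by apply: vcv_cat.
  exists x, (fun j => JPhi (x j) (ns (sg0 (sg j)))); split=> //; split=> //; split; last first.
    exact: (JPhi_cv Hx (vcv_sub sgj (vcv_sub sg0j Hns))).
  move=> j.
  apply: (rnormal_pullback (r := r - norm (vsub (s (sg j)) sb)) (Phi_adiff (x j)) (Gx j) _ _
    (Om := fun z : vec (N + n)%N => F (vl z) (vr z))).
  - by have := near (sg j); lra.
  - move=> x' nx' /GPsi Gx'; rewrite /Phi vl_vcat vr_vcat.
    apply/F_rep; last by exists (vr x').
    have : norm (vsub (vl x') (s (sg j))) <= norm (vsub x' (x j)).
      have := norm_vl (vsub x' (x j)).
      by rewrite (_ : vl (vsub x' (x j)) = vsub (vl x') (vl (x j))) // vl_vcat.
    by have := norm_sub_triangle (s (sg j)) (vl x') sb; lra.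
  - have -> : Phi (x j) = zs (sg0 (sg j)).
      rewrite /Phi vl_vcat vr_vcat; case: (Hv (sg j)) => _ ->.
      exact: vcat_vl_vr.
    exact: Hr.
have PsiE : Psi xb = vcat (H sb) vb by rewrite /Psi vl_vcat vr_vcat.
(* An element [z] of the kernel of [JPsi xb] has zero second block, so its being normal to the graph
   puts [vl z] in the second-order subdifferential at 0, with [DHt sb (vl z) = 0]: this is the
   situation of [SOQC]. *)
have [z Gz Jz|w [Gw Jw]] := lnormal_preimage Psi_adiff JPsi_cv JPsi_scale G_closed _ Lpre.
  have z2 : vr z = vzero by have := congr1 (@vr N m) Jz; rewrite vr_vcat.
  have zE : z = vcat (vl z) (vopp vzero).
    rewrite -[LHS]vcat_vl_vr z2; congr vcat; apply: vec_ext => i.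
    by rewrite /vopp /vzero; lra.
  have z1 : vl z = vzero.
    apply: (SOQC vb_sub vb_y); first by rewrite /sosubdiff /coderiv -zE -PsiE.
    by have := congr1 (@vl N m) Jz; rewrite /JPsi !vl_vcat.
  rewrite zE z1; apply: vec_ext => i; rewrite -(splitK i); case: (split i) => k /=.
    by rewrite vcat_lshift.
  by rewrite vcat_rshift /vopp /vzero; lra.
(* In [JPsi xb w = JPhi xb nb], the second block identifies the argument of the second-order
   subdifferential and the first gives the formula for [p]. *)
exists (vl w).
have w1 : DHt sb (vl w) = vl (JPhi xb nb) by rewrite -Jw /JPsi !vl_vcat.
have w2 : vr w = vr (JPhi xb nb) by rewrite -Jw /JPsi !vr_vcat.
split.
  rewrite /sosubdiff /coderiv -PsiE.
  have -> // : vcat (vl w) (vopp (fun l => vsum (fun i => a l i sb * u i))) = w.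
  rewrite -[RHS]vcat_vl_vr w2; congr vcat; apply: vec_ext => l.
  rewrite /JPhi !vr_vcat vl_vcat /vopp.
  have -> : - vsum (fun i => a l i sb * u i) = -1 * vsum (fun i => a l i sb * u i) by lra.
  by rewrite -vsumZ; apply: eq_vsum => i; lra.
rewrite w1; apply: vec_ext => j; rewrite /vadd /JPhi !vl_vcat !vr_vcat.
have -> : vsum (fun i => vopp u i * vsum (fun l => vb l * Da l i sb j)) =
    -1 * vsum (fun i => vsum (fun l => vb l * Da l i sb j) * u i).
  by rewrite -vsumZ; apply: eq_vsum => i; rewrite /vopp; lra.
lra.
Qed.

End ParametrizedSubgradients.

(** * Strongly amenable functions *)

Section Amenable.
Variables (n d m : nat) (phi : vec n -> vec d -> option R) (xb : vec n) (wb : vec d).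
Variables (theta : vec m -> option R) (h : vec n -> vec d -> vec m).
Variable D1 : 'I_m -> 'I_(n + d)%N -> vec (n + d)%N -> R.
Variable D2 : 'I_m -> 'I_(n + d)%N -> 'I_(n + d)%N -> vec (n + d)%N -> R.
Hypothesis Hamen : strongly_amenable_rep phi xb wb theta h D1 D2.

Let zb := vcat xb wb.
Let H (z : vec (n + d)%N) := h (vl z) (vr z).

Let C2 : is_C2 h D1 D2 := proj1 (proj2 Hamen).
Let theta_proper : proper_fun theta := proj1 (proj2 (proj2 Hamen)).
Let theta_lsc : lsc_fun theta := proj1 (proj2 (proj2 (proj2 Hamen))).
Let theta_convex : convex_fun theta := proj1 (proj2 (proj2 (proj2 (proj2 Hamen)))).
Let QC : forall v, ssubdiff theta (h xb wb) v -> jacx_t D1 zb v = vzero -> v = vzero :=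
  proj2 (proj2 (proj2 (proj2 (proj2 Hamen)))).

Lemma h_fdiff l z : fdiff (fun z' => H z' l) z (fun i => D1 l i z).
Proof.
by apply: C1_fdiff => i; case: (C2 l) => _ /(_ i) [? []].
Qed.

Lemma D1_fdiff l i z : fdiff (D1 l i) z (fun j => D2 l i j z).
Proof.
by apply: C1_fdiff => j; case: (C2 l) => _ /(_ i) [? [_ /(_ j) []]].
Qed.

Lemma D1_cv l zs z : vcv zs z ->
  vcv (fun j => (fun i => D1 l i (zs j)) : vec _) (fun i => D1 l i z).
Proof.
move=> Hz; apply/vcv_coord => i.
by apply: vcont_seq Hz; case: (C2 l) => _ /(_ i) [? []].
Qed.

Lemma D2_cv l i zs z : vcv zs z ->
  vcv (fun j => (fun k => D2 l i k (zs j)) : vec _) (fun k => D2 l i k z).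
Proof.
move=> Hz; apply/vcv_coord => k.
by apply: vcont_seq Hz; case: (C2 l) => _ /(_ i) [? [_ /(_ k) []]].
Qed.

Lemma h_cv zs z : vcv zs z -> vcv (fun j => H (zs j)) (H z).
Proof. by move=> Hz; apply/vcv_coord => l; apply: fdiff_cv (h_fdiff l z) Hz. Qed.

Lemma jacx_t_cv zs z vs v : vcv zs z -> vcv vs v ->
  vcv (fun j => jacx_t D1 (zs j) (vs j)) (jacx_t D1 z v).
Proof.
move=> Hz /vcv_coord Hv; apply/vcv_coord => i; apply: vsum_cv => l.
apply: (CV_mult _ _ _ _ (Hv l)).
by move/vcv_coord: (D1_cv l Hz); apply.
Qed.

Lemma jacx_t_scale z t v : jacx_t D1 z (vscale t v) = vscale t (jacx_t D1 z v).
Proof.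
by apply: vec_ext => i; rewrite /jacx_t /vscale -vsumZ; apply: eq_vsum => l; lra.
Qed.

Lemma h_fdiff_vcatl w l x : fdiff (fun x' => h x' w l) x (vl (fun i => D1 l i (vcat x w))).
Proof.
apply: eq_fdiff (fdiff_vcatl (h_fdiff l (vcat x w))) => // x'.
by rewrite /H vl_vcat vr_vcat.
Qed.

Lemma h_adiff w x : adiff (fun x' => h x' w) x (jacx_t D1 (vcat x w)).
Proof. by move=> v; apply: fdiff_vsum => l; apply: fdiff_scale; apply: h_fdiff_vcatl. Qed.

(** Otherwise unit domain normals in the kernels at points tending to [zb] would accumulate at a
    unit normal in the kernel at [zb]. Stating the condition with [dom_normal] makes this limit
    possible without convergence of the values of [theta]. *)
Lemma qualification_near : (exists b, theta (h xb wb) = Some b) ->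
  exists r, 0 < r /\ forall z, norm (vsub z zb) < r ->
    forall v, dom_normal theta (H z) v -> jacx_t D1 z v = vzero -> v = vzero.
Proof.
move=> theta_dom; apply: NNPP => nH.
have /functional_choice [f Hf] : forall j : nat, exists f : vec (n + d)%N * vec m,
    [/\ norm (vsub f.1 zb) < inv_succ j, dom_normal theta (H f.1) f.2,
     jacx_t D1 f.1 f.2 = vzero & norm f.2 = 1].
  move=> j; apply: NNPP => H'; apply: nH; exists (inv_succ j).
  split=> [|z nz v vn vJ]; first exact: inv_succ_gt0.
  apply: norm_eq0; apply: NNPP => v0.
  have {}v0 : 0 < norm v by have := norm_ge0 v; lra.
  have i0 : 0 < / norm v by apply: Rinv_0_lt_compat.
  apply: H'; exists (z, vscale (/ norm v) v); split=> //=.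
  - by move=> z' b E; rewrite innerZl; have := vn z' b E; nra.
  - by rewrite jacx_t_scale vJ; apply: vec_ext => i; rewrite /vscale /vzero; lra.
  - by rewrite norm_scale Rabs_pos_eq; [field; lra | lra].
have [j|sg [v [sgj Hv]]] := @bolzano_weierstrass _ (fun j => (f j).2) 1.
  by case: (Hf j); lra.
have Hz : vcv (fun j => (f (sg j)).1) zb.
  apply: (vcv_sub (s := fun j => (f j).1) sgj); apply/vcv_norm.
  apply: Un_cv_squeeze inv_succ_cv => j.
  by rewrite Rminus_0_r Rabs_pos_eq; [case: (Hf j); lra | exact: norm_ge0].
have v0 : v = vzero.
  apply: QC.
    apply: dom_normal_ssubdiff => //.
    have := h_cv Hz; rewrite {2}/H /zb vl_vcat vr_vcat => Hh.
    by apply: (dom_normal_closed Hh Hv) => j; case: (Hf (sg j)).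
  apply: vcv_unique (jacx_t_cv Hz Hv) _.
  by apply: eq_vcv (vcv_const vzero) => j; case: (Hf (sg j)).
have := norm_cv Hv; rewrite v0 norm_vzero => /Un_cv_ge_eventually L.
have : 1 <= 0 by apply: L; exists 0%N => j _; case: (Hf (sg j)); lra.
lra.
Qed.

(** Left to right is the limiting chain rule, whose qualification condition at [(x, w)] comes from
    [qualification_near]; right to left is the easy inclusion. *)
Lemma partial_subdiff_rep : (exists b, theta (h xb wb) = Some b) ->
  exists r, 0 < r /\ forall x w, norm (vsub (vcat x w) zb) < r -> forall y,
    subdiff (fun x' => phi x' w) x y <->
    exists v, subdiff theta (h x w) v /\ jacx_t D1 (vcat x w) v = y.
Proof.
move=> /qualification_near [r1 [r10 H1]]; have [[r2 [r20 H2]] _] := Hamen.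
exists (Rmin r1 r2); split=> [|x w /lt_Rmin [/H1 {}H1 n2] y]; first exact: Rmin_glb_lt.
have r0 : 0 < r2 - norm (vsub (vcat x w) zb) by lra.
have loc x' : norm (vsub x' x) < r2 - norm (vsub (vcat x w) zb) -> phi x' w = theta (h x' w).
  move=> nx; apply: H2; have := norm_sub_triangle (vcat x w) (vcat x' w) zb.
  by rewrite norm_vcat_subl /zb in nx *; lra.
rewrite /H vl_vcat vr_vcat in H1.
split=> [/(subdiff_local r0 loc) Hy|[v [Hv <-]]].
  apply: (limiting_chain_rule (Psi := fun x' => h x' w) (J := fun x' => jacx_t D1 (vcat x' w))
    _ _ _ theta_lsc _ Hy).
  - exact: h_adiff.
  - by move=> xs x' vs v Hx Hv; apply: jacx_t_cv Hv; apply: vcv_cat Hx (vcv_const w).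
  - by move=> x'; apply: jacx_t_scale.
  - by move=> v /(ssubdiff_dom_normal theta_convex); apply: H1.
apply: (subdiff_local r0 (psi := fun x' => theta (h x' w))); first by move=> x' /loc.
apply: rsubdiff_subdiff; apply: (csub_comp_rsubdiff (h_adiff w x)).
exact/subdiff_csub.
Qed.

Variable yb : vec n.
Hypothesis Hyb : subdiff (fun x => phi x wb) xb yb.
Hypothesis SOQC : forall v, Mset theta h D1 xb wb yb v ->
  forall w, sosubdiff theta (h xb wb) v vzero w -> jacx_t D1 zb w = vzero -> w = vzero.

Let theta_dom : exists b, theta (h xb wb) = Some b.
Proof.
have [[r [r0 Hr]] _] := Hamen; have [b [E _]] := Hyb.
by exists b; rewrite -Hr // norm_subxx.
Qed.

Lemma sosubdiff_fixed_parameter u p : sosubdiff (fun x => phi x wb) xb yb u p ->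
  exists v, Mset theta h D1 xb wb yb v /\
    exists q, sosubdiff theta (h xb wb) v (jacx D1 zb u) q /\
      p = vadd (hessxx D2 zb v u) (jacx_t D1 zb q).
Proof.
have [r [r0 Hr]] := partial_subdiff_rep theta_dom.
move=> /(coderiv_parametrized (H := fun x => h x wb)
  (DH := fun l x => vl (fun i => D1 l i (vcat x wb)))
  (a := fun l i x => D1 l (lshift d i) (vcat x wb))
  (Da := fun l i x => vl (fun j => D2 l (lshift d i) j (vcat x wb)))
  theta_proper theta_lsc theta_convex _ _ _ _ r0).
have vc xs x : vcv xs x -> vcv (fun j => vcat (xs j) wb) (vcat x wb).
  by move=> Hx; apply: vcv_cat Hx (vcv_const wb).
case.
- by move=> l x; apply: h_fdiff_vcatl.
- by move=> l i x; apply: fdiff_vcatl; apply: D1_fdiff.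
- by move=> l xs x /vc /(D1_cv l) /vcv_vl.
- by move=> l i xs x /vc /(D2_cv l (lshift d i)) /vcv_vl.
- by move=> x nx y; apply: Hr; rewrite norm_vcat_subl.
- exact: theta_dom.
- by move=> v; apply: QC.
- by move=> v Hv vy; apply: SOQC.
by move=> v [Hv [vy [q [Hq E]]]]; exists v; split=> //; exists q.
Qed.

Lemma coderiv_psubdiff u p : coderiv (psubdiff phi) zb yb u p ->
  exists v, Mset theta h D1 xb wb yb v /\
    exists q, sosubdiff theta (h xb wb) v (jacx D1 zb u) q /\
      p = vcat (vadd (hessxx D2 zb v u) (jacx_t D1 zb q))
               (vadd (hessxw D2 zb v u) (jacw_t D1 zb q)).
Proof.
have [r [r0 Hr]] := partial_subdiff_rep theta_dom.
have HE : H zb = h xb wb by rewrite /H vl_vcat vr_vcat.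
move=> /(coderiv_parametrized (H := H) (DH := fun l z => fun i => D1 l i z)
  (a := fun l i => D1 l (lshift d i)) (Da := fun l i z => fun j => D2 l (lshift d i) j z)
  theta_proper theta_lsc theta_convex h_fdiff _ D1_cv _ r0).
rewrite HE; case.
- by move=> l i z; apply: D1_fdiff.
- by move=> l i; apply: D2_cv.
- by move=> z nz y; rewrite /psubdiff Hr vcat_vl_vr.
- exact: theta_dom.
- by move=> v; apply: QC.
(* [DHt] is here the full transposed Jacobian; its first [n] coordinates are [jacx_t], so its kernel
   lies in that of [jacx_t]. *)
- move=> v Hv vy w Hw w0; apply: (SOQC (v := v)) => //.
  by apply: vec_ext => i; have := congr1 (fun g => g (lshift d i)) w0.
move=> v [Hv [vy [q [Hq ->]]]]; exists v; split=> //; exists q; split=> //.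
apply: vec_ext => i; rewrite -(splitK i); case: (split i) => k /=.
  by rewrite vcat_lshift.
by rewrite vcat_rshift.
Qed.

End Amenable.

Theorem theorem3p3 (n d m : nat) (phi : vec n -> vec d -> option R)
  (xb : vec n) (wb : vec d) (theta : vec m -> option R) (h : vec n -> vec d -> vec m)
  (D1 : 'I_m -> 'I_(n + d)%N -> vec (n + d)%N -> R)
  (D2 : 'I_m -> 'I_(n + d)%N -> 'I_(n + d)%N -> vec (n + d)%N -> R)
  (Hamen : strongly_amenable_rep phi xb wb theta h D1 D2)
  (yb : vec n) (Hyb : subdiff (fun x => phi x wb) xb yb)
  (HSOQC : forall v, Mset theta h D1 xb wb yb v ->
     forall w, sosubdiff theta (h xb wb) v vzero w ->
       jacx_t D1 (vcat xb wb) w = vzero -> w = vzero) :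
  forall u : vec n,
    (forall p : vec n, sosubdiff (fun x => phi x wb) xb yb u p ->
       exists v, Mset theta h D1 xb wb yb v /\
         exists q, sosubdiff theta (h xb wb) v (jacx D1 (vcat xb wb) u) q /\
           p = vadd (hessxx D2 (vcat xb wb) v u) (jacx_t D1 (vcat xb wb) q)) /\
    (forall p : vec (n + d)%N, coderiv (psubdiff phi) (vcat xb wb) yb u p ->
       exists v, Mset theta h D1 xb wb yb v /\
         exists q, sosubdiff theta (h xb wb) v (jacx D1 (vcat xb wb) u) q /\
           p = vcat (vadd (hessxx D2 (vcat xb wb) v u) (jacx_t D1 (vcat xb wb) q))
                    (vadd (hessxw D2 (vcat xb wb) v u) (jacw_t D1 (vcat xb wb) q))).
Proof.
move=> u; split=> p.
  exact: (sosubdiff_fixed_parameter Hamen Hyb HSOQC).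
exact: (coderiv_psubdiff Hamen Hyb HSOQC).
Qed.
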